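(* For every $\gamma\in(0,1)$ there exists $\epsilon=\epsilon(\gamma)>0$ such that the following holds. Let $p$ be a sufficiently large prime, let $E\subseteq\mathbb{F}_p^2$, and let $S\subseteq SL_2(\mathbb{F}_p)$ be a symmetric subset such that $p^{\gamma}<|S|<p^{3-2\gamma}$ and $|S\cap gH|<p^{-\gamma/2}|S|$ for every proper subgroup $H\subsetneq SL_2(\mathbb{F}_p)$ and every $g\in SL_2(\mathbb{F}_p)$. Suppose every line through the origin contains at most $k$ points of $E$. Then \[|S(E)|\gg \min\left\{p^2,~\max\left\{\frac{|S||E|}{pk},~\frac{|S|^{1/2}|E|}{p^{\frac{1-\epsilon}{2}}k^{1/2}}\right\}\right\}.\]
   Context: $S$ symmetric means $S=S^{-1}=\{\theta^{-1}:\theta\in S\}$. Matrices act on $\mathbb{F}_p^2$ as linear maps on column vectors, and $S(E)=\{\theta x: x\in E,\ \theta\in S\}$. A line through the origin is a one-dimensional subspace of $\mathbb{F}_p^2$. $X\gg Y$ means $X\ge cY$ for a constant $c>0$ independent of $p,E,S,k$.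
   Formalization: The formal theorem additionally assumes E is not {0}; for E = {0} and k = 1 one has |S(E)| = 1 while |S||E|/(pk) = |S|/p can be a positive power of p, so the stated bound fails there. *)

(* Defs.v *)
From HB Require Import structures.
From mathcomp Require Import all_boot all_order all_algebra all_fingroup.
From mathcomp Require Import reals exp.

Set Implicit Arguments.
Unset Strict Implicit.
Unset Printing Implicit Defensive.

Import Order.TTheory GRing.Theory Num.Theory.
Local Open Scope ring_scope.

Definition SL2 (p : nat) : {set {'GL_2['F_p]}} :=
  [set g : {'GL_2['F_p]} | \det (GLval g) == 1].

Lemma SL2_group_set (p : nat) : group_set (SL2 p).
Proof.
apply/group_setP; split=> [|x y]; first by rewrite inE GL_1E det1.
by rewrite !inE GL_ME det_mulmx => /eqP-> /eqP->; rewrite mulr1.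
Qed.

Canonical SL2_group (p : nat) : {group {'GL_2['F_p]}} :=
  Group (SL2_group_set p).

Definition image_set (p : nat) (S : {set {'GL_2['F_p]}})
    (E : {set 'cV['F_p]_2}) : {set 'cV['F_p]_2} :=
  [set GLval g *m x | g in S, x in E].

Definition lines_meet_at_most (p : nat) (E : {set 'cV['F_p]_2}) (k : nat) :
    Prop :=
  forall L : {vspace 'cV['F_p]_2}, \dim L = 1%N ->
    (#|[set x in E | x \in L]| <= k)%N.

(* Main.v *)
Require Import Defs.
From HB Require Import structures.
From mathcomp Require Import all_boot all_order all_algebra all_fingroup.
From mathcomp Require Import reals exp.
From mathcomp Require Import ring lra zify.

Set Implicit Arguments.
Unset Strict Implicit.
Unset Printing Implicit Defensive.

Import Order.TTheory GRing.Theory Num.Theory.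
Local Open Scope ring_scope.

(* A variance computation over [SL_2(F_p)] acting on the plane (the pairs
   [(e, f)], [(e', f')] with [g e = f], [g e' = f'] satisfy
   [det(e, e') = det(f, f')], a point-hyperplane incidence in dimension 4 that is
   invariant under scaling) shows that few [g] can map many points of [E] into
   [F].  This gives [|S(E)| >> |S||E|/(pk)].

   The second bound only improves on this and on [|S(E)| >= |E|] when
   [|S(E)| <= N|E|] and [pk <= N|S|] for a small power [N] of [p].  Choosing a
   random point of [S(E)] then yields a large [B] in [S] such that [B^-1 B] is not
   much larger than [B]; the popular quotients of [B] form a set [A] with small
   powers, not contained in a proper subgroup because [S] does not concentrate
   on cosets.  For such [A], every conjugacy class of regular semisimple elements
   contains at most about [|A|^(2/3)] elements of [A^4], so a torus meeting [A^2]
   in one regular element meets it in about [|A|^(1/3)] elements.  This property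
   propagates to all conjugates of the torus, and as there are about [p^2] of them
   [|A|] is at least about [p^3], against [|S| < p^(3 - 2 gamma)]. *)

(** * Matrices of size two *)

(** The exponent 2/3 comes from sending a triple [(x1, x2, x3)] in one class to [u = x1 x2] and
    [v = x2 x3], both in [A^8]. Once [u], [v] are fixed, [y = x2^-1] has prescribed [tr y],
    [tr (u y)], [tr (v y)] and determinant 1: a line meeting a quadric, hence two solutions. The
    obstacle is degeneracy: [u] and [v] may commute, or the line may lie on the quadric. Such
    triples are rare because only about [|A|^(1/2)] elements of a small power of [A] send a given
    nonzero vector to a given vector. Orbit and stabilizer then turn 2/3 into the 1/3 for tori.
    Propagation has no accumulated cost: passing to a conjugate torus loses a factor [M], but any
    regular element of [A^2] found there restores the original lower bound, so words of arbitrary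
    length in [A] are allowed. Counting regular elements in conjugate tori gives
    [p^3 |A|^(1/3) << p |A|], that is [|A| >> p^3]. Every loss is a power of one integer [N], at
    most [p^(2 eps)], and [eps] is small enough for the total [N^kappa] to stay below
    [p^(gamma / 2)]. *)

Section Mx2.
Variable F : fieldType.
Implicit Types (A B g h y d n w x : 'M[F]_2) (e f : 'cV[F]_2).

Lemma mul2E m A (B : 'M[F]_(2, m)) i j :
  (A *m B) i j = A i 0 * B 0 j + A i 1 * B 1 j.
Proof.
rewrite mxE big_ord_recl big_ord1; congr (_ * _ + A i _ * B _ j); exact/val_inj.
Qed.

Lemma tr2E A : \tr A = A 0 0 + A 1 1.
Proof.
rewrite /mxtrace big_ord_recl big_ord1; congr (_ + A _ _); exact/val_inj.
Qed.

Lemma ord2P (P : 'I_2 -> Prop) : P 0 -> P 1 -> forall i, P i.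
Proof.
move=> P0 P1 i; have [->|->] // : i = 0 \/ i = 1.
by case: i => [[|[|//]] ?]; [left|right]; apply: val_inj.
Qed.

Lemma mx2P A B : A 0 0 = B 0 0 -> A 0 1 = B 0 1 -> A 1 0 = B 1 0 ->
  A 1 1 = B 1 1 -> A = B.
Proof.
by move=> *; apply/matrixP; apply: ord2P; apply: ord2P.
Qed.

Lemma cV2P e f : e 0 0 = f 0 0 -> e 1 0 = f 1 0 -> e = f.
Proof. by move=> *; apply/matrixP; apply: ord2P => j; rewrite ord1. Qed.

(** The area form: [SL_2] preserves it and it vanishes exactly on linearly dependent pairs, so lines
    through the origin can be handled by equations. *)
Definition om e f : F := e 0 0 * f 1 0 - e 1 0 * f 0 0.


Lemma det2E A : \det A = A 0 0 * A 1 1 - A 0 1 * A 1 0.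
Proof.
rewrite (expand_det_row _ 0) big_ord_recl big_ord1 /cofactor !det_mx11 !mxE /=.
rewrite expr0 expr1 mul1r mulN1r mulrN.
by congr (_ * A _ _ - A _ _ * A _ _); apply: val_inj.
Qed.

Definition mx2E := (mul2E, tr2E, det2E, mxE, mulr1n, mulr0n).

(** Proves an equation modulo the relation [l = 0]: the caller supplies the cofactor [c], and [ring]
    or [field] checks what remains. *)
Lemma lincomb1 (x y c l : F) : l = 0 -> x - y = c * l -> x = y.
Proof. by move=> -> /eqP; rewrite mulr0 subr_eq0 => /eqP. Qed.

Lemma lincomb2 (x y c l c' l' : F) : l = 0 -> l' = 0 ->
  x - y = c * l + c' * l' -> x = y.
Proof. by move=> -> -> /eqP; rewrite !mulr0 addr0 subr_eq0 => /eqP. Qed.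

Lemma om_mul g e f : om (g *m e) (g *m f) = \det g * om e f.
Proof. by rewrite /om !mx2E; ring. Qed.

Lemma neq0_entry A : A != 0 -> exists (i j : 'I_2), A i j != 0.
Proof.
move=> A0; have [i /existsP[j Aij]|H] := pickP (fun i : 'I_2 => [exists j : 'I_2, A i j != 0]).
  by exists i, j.
case/eqP: A0; apply/matrixP => i j; rewrite mxE; apply/eqP/negPn/negP => Aij.
by have /existsP[] := H i; exists j.
Qed.

(* [gh - hg] is the cross product of the traceless parts of [g] and [h], so a
   matrix orthogonal to [1], [g] and [h] for the trace form is parallel to it. *)
Lemma comm_parallel_entries g h d :
  \tr d = 0 -> \tr (g *m d) = 0 -> \tr (h *m d) = 0 ->
  forall i j k l, (g *m h - h *m g) i j * d k l = (g *m h - h *m g) k l * d i j.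
Proof.
move=> d0 dg dh; set n := g *m h - h *m g.
have {}d0 : d 1 1 = - d 0 0.
  by apply/eqP; rewrite -addr_eq0 addrC -tr2E d0.
have n0 : n 1 1 = - n 0 0 by rewrite /n !mx2E; ring.
have E1 : n 0 0 * d 0 1 = n 0 1 * d 0 0.
  apply: (lincomb2 (c := g 0 1) (c' := - h 0 1) dh dg).
  by rewrite /n !mx2E d0; ring.
have E2 : n 0 0 * d 1 0 = n 1 0 * d 0 0.
  apply: (lincomb2 (c := - g 1 0) (c' := h 1 0) dh dg).
  by rewrite /n !mx2E d0; ring.
have E3 : n 0 1 * d 1 0 = n 1 0 * d 0 1.
  apply: (lincomb2 (c := g 0 0 - g 1 1) (c' := - (h 0 0 - h 1 1)) dh dg).
  by rewrite /n !mx2E d0; ring.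
clearbody n.
by apply: ord2P; apply: ord2P; apply: ord2P; apply: ord2P;
  rewrite ?d0 ?n0 ?mulrN ?mulNr ?opprK ?E1 ?E2 ?E3.
Qed.

Lemma comm_parallel g h d : g *m h - h *m g != 0 ->
  \tr d = 0 -> \tr (g *m d) = 0 -> \tr (h *m d) = 0 ->
  exists c, d = c *: (g *m h - h *m g).
Proof.
move=> /neq0_entry[i [j nij]] d0 dg dh.
exists (d i j / (g *m h - h *m g) i j); apply/matrixP => k l; rewrite [RHS]mxE.
by rewrite mulrAC [d i j * _]mulrC -(comm_parallel_entries d0 dg dh i j) mulrAC mulfV ?mul1r.
Qed.

Lemma comm_parallel_l g h d : d != 0 ->
  \tr d = 0 -> \tr (g *m d) = 0 -> \tr (h *m d) = 0 ->
  exists c, g *m h - h *m g = c *: d.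
Proof.
move=> /neq0_entry[i [j dij]] d0 dg dh.
exists ((g *m h - h *m g) i j / d i j); apply/matrixP => k l; rewrite [RHS]mxE.
by rewrite mulrAC (comm_parallel_entries d0 dg dh i j) mulfK.
Qed.

Lemma det_addZ y n s : \tr n = 0 ->
  \det (y + s *: n) = \det y - s * \tr (y *m n) + s ^+ 2 * \det n.
Proof.
move=> n0; have {}n0 : n 1 1 = - n 0 0.
  by apply/eqP; rewrite -addr_eq0 addrC -tr2E n0.
by rewrite !mx2E n0; ring.
Qed.

Lemma tr_mulB g y y' : \tr (g *m y) = \tr (g *m y') -> \tr (g *m (y - y')) = 0.
Proof. by move=> E; rewrite mulmxBr linearB /= E subrr. Qed.

Lemma trB0 y y' : \tr y = \tr y' -> \tr (y - y') = 0.
Proof. by move=> E; rewrite linearB /= E subrr. Qed.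

(** The traces confine [y'] to the line [y + s n]. On it the determinant is quadratic in [s] with
    leading coefficient [det n], so the condition has the root [s = 0] and one other. *)
Lemma three_traces_two g h y y' : \det (g *m h - h *m g) != 0 ->
  \det y' = \det y -> \tr y' = \tr y -> \tr (g *m y') = \tr (g *m y) ->
  \tr (h *m y') = \tr (h *m y) ->
  let n := g *m h - h *m g in
  y' = y \/ y' = y + (\tr (y *m n) / \det n) *: n.
Proof.
move=> dn dy ty tg th n.
have n0 : n != 0 by apply: contraNneq dn => E; rewrite -/n E det0.
have [s ds] := comm_parallel n0 (trB0 ty) (tr_mulB tg) (tr_mulB th).
have tn : \tr n = 0 by rewrite /n !mx2E; ring.
have Ey : y' = y + s *: n by rewrite -ds addrC subrK.
have [s0|s0] := eqVneq s 0; first by left; rewrite Ey s0 scale0r addr0.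
right; rewrite Ey; congr (_ + _ *: _).
move: dy; rewrite Ey det_addZ // => /eqP; rewrite -addrA -subr_eq0 addrAC subrr add0r.
rewrite expr2 -mulrA addrC -mulrBr mulf_eq0 (negPf s0) /= subr_eq0 => /eqP <-.
by rewrite mulfK.
Qed.

Lemma det0_vec A : \det A = 0 -> exists2 e : 'cV[F]_2, e != 0 & A *m e = 0.
Proof.
move=> dA; have /eqP/det0P[v v0 vA] : \det A^T = 0 by rewrite det_tr.
exists v^T; first by apply: contraNneq v0 => /(congr1 trmx); rewrite trmxK trmx0 => ->.
by rewrite -[A]trmxK -trmx_mul vA trmx0.
Qed.

(** Here [y' - y] is a multiple of the singular matrix [n], so it kills a kernel vector of [n]. *)
Lemma three_traces_vec g h : g *m h - h *m g != 0 ->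
  \det (g *m h - h *m g) = 0 ->
  exists2 e : 'cV[F]_2, e != 0 & forall y y', \tr y' = \tr y ->
  \tr (g *m y') = \tr (g *m y) -> \tr (h *m y') = \tr (h *m y) ->
  y' *m e = y *m e.
Proof.
move=> n0 /det0_vec[e e0 ne]; exists e => // y y' ty tg th.
have [s ds] := comm_parallel n0 (trB0 ty) (tr_mulB tg) (tr_mulB th).
have -> : y' = y + s *: (g *m h - h *m g) by rewrite -ds addrC subrK.
by rewrite mulmxDl -scalemxAl ne scaler0 addr0.
Qed.

(** For singular [n] the determinant is affine along [y + s n], so a second solution forces
    [tr (y n) = 0]. Then [n] is orthogonal to [1], [u] and [y], which makes the commutator of [u]
    and [y] a multiple of [n], hence singular. *)
Lemma three_traces_one u v y y' : u *m v - v *m u != 0 ->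
  \det (u *m v - v *m u) = 0 -> \det (u *m y - y *m u) != 0 ->
  \det y' = \det y -> \tr y' = \tr y -> \tr (u *m y') = \tr (u *m y) ->
  \tr (v *m y') = \tr (v *m y) -> y' = y.
Proof.
set n := u *m v - v *m u => n0 dn duy dy ty tu tv.
have [s ds] := comm_parallel n0 (trB0 ty) (tr_mulB tu) (tr_mulB tv).
have tn : \tr n = 0 by rewrite /n !mx2E; ring.
have tun : \tr (u *m n) = 0 by rewrite /n !mx2E; ring.
have Ey : y' = y + s *: n by rewrite -ds addrC subrK.
have [s0|s0] := eqVneq s 0; first by rewrite Ey s0 scale0r addr0.
case/eqP: duy; have tyn : \tr (y *m n) = 0.
  move: dy; rewrite Ey det_addZ // dn mulr0 addr0 => /eqP.
  by rewrite -subr_eq0 addrAC subrr add0r oppr_eq0 mulf_eq0 (negPf s0) => /eqP.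
have [c ->] := comm_parallel_l n0 tn tun tyn.
by rewrite detZ dn mulr0.
Qed.

(** A Fricke identity: in determinant 1 the right-hand side is 2 minus the trace of the group
    commutator. *)
Lemma det_comm g h : \det (g *m h - h *m g) =
  4%:R * \det g * \det h + \tr g * \tr h * \tr (g *m h)
  - \tr g ^+ 2 * \det h - \tr h ^+ 2 * \det g - \tr (g *m h) ^+ 2.
Proof. by rewrite !mx2E; ring. Qed.

(** Commuting means that the traceless parts have zero cross product, so that of [y] is [b] times
    that of [z]; [b] is read off at a nonzero coordinate of [z]. *)
Lemma comm_nonscalar z y : ~~ is_scalar_mx z -> y *m z = z *m y ->
  exists a b, y = a%:M + b *: z.
Proof.
move=> zns yz.
have yz00 : y 0 1 * z 1 0 - z 0 1 * y 1 0 = 0.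
  have /matrixP/(_ 0 0) := yz; rewrite !mx2E => /eqP; rewrite -subr_eq0 => /eqP E.
  by rewrite -[RHS]E; ring.
have yz01 : (y 0 0 - y 1 1) * z 0 1 - y 0 1 * (z 0 0 - z 1 1) = 0.
  have /matrixP/(_ 0 1) := yz; rewrite !mx2E => /eqP; rewrite -subr_eq0 => /eqP E.
  by rewrite -[RHS]E; ring.
have yz10 : (y 0 0 - y 1 1) * z 1 0 - y 1 0 * (z 0 0 - z 1 1) = 0.
  have /matrixP/(_ 1 0) := yz; rewrite !mx2E => /eqP; rewrite -subr_eq0 => /eqP E.
  by rewrite -[LHS]opprK -[RHS]oppr0 -[in RHS]E; congr (- _); ring.
have fin b : y 0 1 = b * z 0 1 -> y 1 0 = b * z 1 0 ->
    y 0 0 - y 1 1 = b * (z 0 0 - z 1 1) -> exists a b, y = a%:M + b *: z.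
  move=> E1 E2 E3; exists (y 0 0 - b * z 0 0), b.
  have {}E3 : y 1 1 = y 0 0 - b * (z 0 0 - z 1 1) by rewrite -E3; ring.
  by apply: mx2P; rewrite !mx2E ?E1 ?E2 ?E3 /= ?mulr0n; ring.
have [z01|z01] := eqVneq (z 0 1) 0; last first.
  apply: (fin (y 0 1 / z 0 1)); first by rewrite mulfVK.
  - by apply: (lincomb1 (c := - (z 0 1)^-1) yz00); field.
  - by apply: (lincomb1 (c := (z 0 1)^-1) yz01); field.
have [z10|z10] := eqVneq (z 1 0) 0; last first.
  apply: (fin (y 1 0 / z 1 0)); last by apply: (lincomb1 (c := (z 1 0)^-1) yz10); field.
  - by apply: (lincomb1 (c := (z 1 0)^-1) yz00); field.
  - by rewrite mulfVK.
have [zd|zd] := eqVneq (z 0 0 - z 1 1) 0; last first.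
  apply: (fin ((y 0 0 - y 1 1) / (z 0 0 - z 1 1))); last by rewrite mulfVK.
  - by apply: (lincomb1 (c := - (z 0 0 - z 1 1)^-1) yz01); field.
  - by apply: (lincomb1 (c := - (z 0 0 - z 1 1)^-1) yz10); field.
case/is_scalar_mxP: zns; exists (z 0 0); apply: mx2P; rewrite !mx2E //= ?mulr0n //.
by apply/eqP; rewrite eq_sym -subr_eq0 zd.
Qed.


Lemma mul_tr_sub x : (\tr x)%:M *m x - x *m x = (\det x)%:M.
Proof. by apply: mx2P; rewrite !mx2E /= ?mulr0n; ring. Qed.

Lemma invmx_det1 x : \det x = 1 -> invmx x = (\tr x)%:M - x.
Proof.
move=> dx; have ux : x \in unitmx by rewrite unitmxE dx unitr1.
by apply: (can_inj (mulmxK ux)); rewrite mulVmx // mulmxBl mul_tr_sub dx.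
Qed.

Lemma tr_invmx_det1 x : \det x = 1 -> \tr (invmx x) = \tr x.
Proof. by move=> dx; rewrite invmx_det1 // !mx2E /=; ring. Qed.

(** Writing [v = a + b u], the trace of [x3 = x2^-1 v] gives [a + b = 1], and then [det v = 1] gives
    [a b (tr u - 2) = 0]. *)
Lemma third_factor x1 x2 x3 : \det x1 = 1 -> \det x2 = 1 -> \det x3 = 1 ->
  \tr x2 = \tr x1 -> \tr x3 = \tr x1 -> \tr x1 != 0 -> \tr (x1 *m x2) != 2%:R ->
  ~~ is_scalar_mx (x1 *m x2) ->
  (x2 *m x3) *m (x1 *m x2) = (x1 *m x2) *m (x2 *m x3) ->
  x2 *m x3 = 1%:M \/ x2 *m x3 = x1 *m x2.
Proof.
set u := x1 *m x2; set v := x2 *m x3 => d1 d2 d3 t2 t3 t0 tu us uv.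
have [a [b vE]] := comm_nonscalar us uv.
have ux2 : x2 \in unitmx by rewrite unitmxE d2 unitr1.
have x3E : x3 = invmx x2 *m v by rewrite mulKmx.
have ab : a + b = 1.
  apply: (mulfI t0); rewrite mulr1 -[RHS]t3 x3E vE.
  have tx1 : \tr (invmx x2 *m u) = \tr x1.
    by rewrite mxtrace_mulC -mulmxA mulmxV // mulmx1.
  rewrite mulmxDr linearD /= -scalemxAr mul_mx_scalar !linearZ /= tx1.
  by rewrite tr_invmx_det1 // t2; ring.
have du : \det u = 1 by rewrite det_mulmx d1 d2 mulr1.
have dv : a * b * (\tr u - 2%:R) = 0.
  have : \det v = 1 by rewrite det_mulmx d2 d3 mulr1.
  rewrite vE; have -> : \det (a%:M + b *: u) = a ^+ 2 + a * b * \tr u + b ^+ 2 * \det u.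
    by rewrite !mx2E /=; ring.
  rewrite du => E; have <- : (a ^+ 2 + a * b * \tr u + b ^+ 2 * 1) - (a + b) ^+ 2 = 0.
    by rewrite E ab expr1n subrr.
  by ring.
move/eqP: dv; rewrite !mulf_eq0 subr_eq0 (negPf tu) orbF => /orP[]/eqP E.
  by right; rewrite vE; move: ab; rewrite E add0r => ->; rewrite scale1r raddf0 add0r.
by left; rewrite vE; move: ab; rewrite E addr0 => ->; rewrite scale0r addr0.
Qed.

(** Such an [n] is nilpotent, of the form [f |-> c om(e, f) e] with [c] nonzero, so
    [tr (w n) = c om(e, w e)]. The proof checks this entrywise. *)
Lemma nilp_kernel_eigen w n e : n != 0 -> \tr n = 0 -> \tr (w *m n) = 0 ->
  n *m e = 0 -> e != 0 -> om e (w *m e) = 0.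
Proof.
move=> n0 tn twn ne e0.
have {}tn : n 1 1 = - n 0 0 by apply/eqP; rewrite -addr_eq0 addrC -tr2E tn.
have k0 : n 0 0 * e 0 0 + n 0 1 * e 1 0 = 0.
  by have /matrixP/(_ 0 0) := ne; rewrite !mx2E.
have k1 : n 1 0 * e 0 0 - n 0 0 * e 1 0 = 0.
  by have /matrixP/(_ 1 0) := ne; rewrite !mx2E tn mulNr.
have E1 : n 0 1 * om e (w *m e) = 0.
  have -> : n 0 1 * om e (w *m e) = e 0 0 ^+ 2 * \tr (w *m n)
     + (w 1 1 * e 0 0 - w 0 0 * e 0 0 - w 0 1 * e 1 0)
         * (n 0 0 * e 0 0 + n 0 1 * e 1 0)
     - w 0 1 * e 0 0 * (n 1 0 * e 0 0 - n 0 0 * e 1 0).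
    by rewrite /om !mx2E tn; ring.
  by rewrite twn k0 k1 !mulr0 addr0 subr0.
have E2 : n 1 0 * om e (w *m e) = 0.
  have -> : n 1 0 * om e (w *m e) = - e 1 0 ^+ 2 * \tr (w *m n)
     + (w 1 0 * e 0 0 + w 1 1 * e 1 0 - w 0 0 * e 1 0)
         * (n 1 0 * e 0 0 - n 0 0 * e 1 0)
     + w 1 0 * e 1 0 * (n 0 0 * e 0 0 + n 0 1 * e 1 0).
    by rewrite /om !mx2E tn; ring.
  by rewrite twn k0 k1 !mulr0 !addr0.
apply/eqP; move/eqP: E1; rewrite mulf_eq0 => /orP[/eqP n01|//].
move/eqP: E2; rewrite mulf_eq0 => /orP[/eqP n10|//].
move: k0 k1; rewrite n01 n10 !mul0r addr0 sub0r => /eqP + /eqP.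
have [n00|n00] := eqVneq (n 0 0) 0.
  by case/eqP: n0; apply: mx2P; rewrite ?tn ?n00 ?n01 ?n10 !mxE ?oppr0.
rewrite oppr_eq0 !mulf_eq0 (negPf n00) /= => /eqP e00 /eqP e10.
by case/eqP: e0; apply: cV2P; rewrite mxE.
Qed.

(** [om e (w e)] is a binary quadratic form in [e] with coefficients [w 1 0], [w 1 1 - w 0 0] and
    [- w 0 1]; three distinct projective zeros make it vanish. The product of the [om ei ej] is the
    Vandermonde determinant of the system. *)
Lemma three_eigenlines w e1 e2 e3 :
  om e1 (w *m e1) = 0 -> om e2 (w *m e2) = 0 -> om e3 (w *m e3) = 0 ->
  om e1 e2 != 0 -> om e1 e3 != 0 -> om e2 e3 != 0 -> is_scalar_mx w.
Proof.
move=> q1 q2 q3 o12 o13 o23.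
have V0 : om e1 e2 * om e1 e3 * om e2 e3 != 0 by rewrite !mulf_neq0.
have w10 : w 1 0 = 0.
  apply: (mulfI V0); rewrite mulr0.
  transitivity (om e1 (w *m e1) * (e2 1 0 * e3 1 0 * om e2 e3)
    - om e2 (w *m e2) * (e1 1 0 * e3 1 0 * om e1 e3)
    + om e3 (w *m e3) * (e1 1 0 * e2 1 0 * om e1 e2)).
    by rewrite /om !mx2E; ring.
  by rewrite q1 q2 q3 !mul0r subrr addr0.
have w01 : w 0 1 = 0.
  apply: (mulfI V0); rewrite mulr0.
  transitivity (- (om e1 (w *m e1) * (e2 0 0 * e3 0 0 * om e2 e3)
    - om e2 (w *m e2) * (e1 0 0 * e3 0 0 * om e1 e3)
    + om e3 (w *m e3) * (e1 0 0 * e2 0 0 * om e1 e2))).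
    by rewrite /om !mx2E; ring.
  by rewrite q1 q2 q3 !mul0r subrr addr0 oppr0.
have w11 : w 1 1 = w 0 0.
  apply/eqP; rewrite -subr_eq0; apply/eqP; apply: (mulfI V0); rewrite mulr0.
  transitivity (- (om e1 (w *m e1) * (e2 0 0 * e3 1 0 + e2 1 0 * e3 0 0) * om e2 e3
    - om e2 (w *m e2) * (e1 0 0 * e3 1 0 + e1 1 0 * e3 0 0) * om e1 e3
    + om e3 (w *m e3) * (e1 0 0 * e2 1 0 + e1 1 0 * e2 0 0) * om e1 e2)).
    by rewrite /om !mx2E; ring.
  by rewrite q1 q2 q3 !mul0r subrr addr0 oppr0.
by apply/is_scalar_mxP; exists (w 0 0); apply: mx2P; rewrite !mx2E //= ?mulr0n.
Qed.

(** With [y = a + b z], the discriminant of [y] is [b^2] times that of [z], so only the sign of [b]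
    is free. The opposite sign gives the adjugate of [y0]. *)
Lemma centralizer_trace z y y0 : (2%:R : F) != 0 -> ~~ is_scalar_mx z ->
  \tr z ^+ 2 != 4%:R * \det z -> y *m z = z *m y -> y0 *m z = z *m y0 ->
  \tr y = \tr y0 -> \det y = \det y0 -> y = y0 \/ y = (\tr y0)%:M - y0.
Proof.
move=> c2 zs disc /(comm_nonscalar zs)[a [b ->]] /(comm_nonscalar zs)[a0 [b0 ->]].
have trE (r s : F) : \tr (r%:M + s *: z) = 2%:R * r + s * \tr z.
  by rewrite !mx2E /=; ring.
have detE (r s : F) : \det (r%:M + s *: z) = r ^+ 2 + r * s * \tr z + s ^+ 2 * \det z.
  by rewrite !mx2E /=; ring.
rewrite !trE !detE => ET ED.
have : (b - b0) * (b + b0) * (\tr z ^+ 2 - 4%:R * \det z) = 0.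
  transitivity ((2%:R * a + b * \tr z) ^+ 2
      - 4%:R * (a ^+ 2 + a * b * \tr z + b ^+ 2 * \det z)
    - ((2%:R * a0 + b0 * \tr z) ^+ 2
      - 4%:R * (a0 ^+ 2 + a0 * b0 * \tr z + b0 ^+ 2 * \det z))).
    by ring.
  by rewrite ET ED subrr.
move/eqP; rewrite !mulf_eq0 [_ ^+ 2 - _ == 0]subr_eq0 (negPf disc) orbF subr_eq0 addr_eq0.
case/orP => /eqP Eb; subst b.
  by left; move/addIr/(mulfI c2): ET => ->.
right; have -> : a = a0 + b0 * \tr z.
  by apply: (mulfI c2); apply: (lincomb1 (c := 1) (l := (2%:R * a + - b0 * \tr z)
     - (2%:R * a0 + b0 * \tr z))); [rewrite ET subrr|ring].
by apply: mx2P; rewrite !mx2E /= ?mulr0n; ring.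
Qed.

End Mx2.

(** * Point-hyperplane incidences *)

(** Translation by a multiple of [x0] carries each fiber onto any other, so all [|F|] fibers have
    the same size. *)
Lemma card_linear_fiber (F : finFieldType) (X : finLmodType F) (phi : X -> F)
    (phiD : forall x y, phi (x + y) = phi x + phi y) x0 (phi0 : phi x0 != 0)
    (phiZ : forall a, phi (a *: x0) = a * phi x0) c :
  (#|F| * #|[set x | phi x == c]|)%N = #|X|.
Proof.
rewrite -[#|X|]sum1_card (partition_big phi predT) //=.
rewrite -[#|F|]sum1_card big_distrl /=; apply: eq_bigr => d _; rewrite mul1n.
rewrite sum1dep_card; set t := ((d - c) / phi x0) *: x0.
have phit : phi t = d - c by rewrite /t phiZ divfK.
rewrite -[LHS](card_imset _ (addIr t)); apply: eq_card => x.
apply/imsetP/idP => [[y]|].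
  by rewrite !inE => /eqP yc ->; rewrite phiD yc phit addrC subrK.
rewrite inE => /eqP xd; exists (x - t); last by rewrite subrK.
by rewrite inE -(inj_eq (addIr (phi t))) -phiD subrK phit xd addrC subrK.
Qed.

Lemma natr_card (R : pzSemiRingType) (T : finType) (P : pred T) :
  #|[set x | P x]|%:R = \sum_x (P x)%:R :> R.
Proof.
by rewrite -sum1dep_card natr_sum big_mkcond; apply: eq_bigr => x _; case: (P x).
Qed.

Section Incidence.
Variables (F : finFieldType) (X : finLmodType F) (B : X -> X -> F).
Hypothesis BDl : forall x x' y, B (x + x') y = B x y + B x' y.
Hypothesis BZl : forall a x y, B (a *: x) y = a * B x y.
Hypothesis BDr : forall x y y', B x (y + y') = B x y + B x y'.
Hypothesis BZr : forall a x y, B x (a *: y) = a * B x y.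
Hypothesis Bnd : forall y, y != 0 -> exists x, B x y != 0.
Hypothesis cardX : #|X| = (#|F| ^ 4)%N.

Local Notation q := #|F|.

Let q_gt0 : (0 < q)%N. Proof. by apply/card_gt0P; exists 0. Qed.

Lemma card_orth1 y : y != 0 -> #|[set x | B x y == 0]| = (q ^ 3)%N.
Proof.
move=> /Bnd[x0 Bx0]; apply/eqP; rewrite -(eqn_pmul2l q_gt0) -expnS -cardX.
by rewrite (@card_linear_fiber _ _ (B^~ y) _ x0).
Qed.

(** Gram-Schmidt produces [x0], [x1] dual, up to a scalar, to [y] and [y2 = y' - B(x0, y') y].
    Adding their combinations to the orthogonal set is injective, so its size times [q^2] is at most
    [q^4]. *)
Lemma card_orth2 y y' : y != 0 -> (forall l, y' != l *: y) ->
  (#|[set x | (B x y == 0%R) && (B x y' == 0%R)]| <= q ^ 2)%N.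
Proof.
move=> y0 indep; have [x0' Bx0'] := Bnd y0.
pose x0 := (B x0' y)^-1 *: x0'.
have Bx0 : B x0 y = 1 by rewrite BZl mulVf.
pose y2 := y' + (- B x0 y') *: y.
have y20 : y2 != 0.
  by apply: contraNneq (indep (B x0 y')); rewrite /y2 scaleNr => /eqP; rewrite subr_eq0.
have [x1' Bx1'] := Bnd y20.
have Bx0y2 : B x0 y2 = 0 by rewrite BDr BZr Bx0 mulr1 subrr.
pose x1 := x1' + (- B x1' y) *: x0.
have Bx1 : B x1 y = 0 by rewrite BDl BZl Bx0 mulr1 subrr.
have Bx1y2 : B x1 y2 != 0 by rewrite BDl BZl Bx0y2 mulr0 addr0.
set K := [set x | _]; clearbody x1; clearbody x0.
pose h (t : X * (F * F)) := t.1 + (t.2.1 *: x0 + t.2.2 *: x1).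
have KP z : z \in K -> B z y = 0 /\ B z y2 = 0.
  rewrite inE => /andP[/eqP E1 /eqP E2]; split=> //.
  by rewrite BDr BZr E1 E2 mulr0 addr0.
have injh : {in setX K [set: F * F] &, injective h}.
  move=> [z [a b]] [z' [a' b']]; rewrite !in_setX !inE !andbT /= => zK z'K.
  rewrite /h /= => E.
  have [Bz Bz2] : B z y = 0 /\ B z y2 = 0 by apply: KP; rewrite inE.
  have [Bz' Bz2'] : B z' y = 0 /\ B z' y2 = 0 by apply: KP; rewrite inE.
  have Ea : a = a'.
    have := congr1 (B^~ y) E; rewrite /= !BDl !BZl Bz Bz' Bx0 Bx1.
    by rewrite !add0r !mulr1 !mulr0 !addr0.
  have Eb : b = b'.
    have := congr1 (B^~ y2) E; rewrite /= !BDl !BZl Bz2 Bz2' Bx0y2.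
    by rewrite !add0r !mulr0 !add0r; apply: mulIf.
  by move: E; rewrite Ea Eb => /addIr ->.
have := subset_leq_card (subsetT (h @: setX K [set: F * F])).
rewrite card_in_imset // cardsX !cardsT card_prod cardX.
by rewrite -[(q ^ 4)%N]/(q ^ (2 + 2))%N expnD -[(q * q)%N]/(q ^ 2)%N leq_pmul2r ?expn_gt0 ?q_gt0.
Qed.

Variables (P : {set X}) (k : nat).
Hypothesis P0 : 0 \notin P.
Hypothesis Pk : forall x, x \in P -> (#|[set l : F | l *: x \in P]| <= k)%N.

Local Notation Q := (q%:R : rat).
(** [f] is [h] minus its mean over the space. Both are unchanged by nonzero scaling, so in a sum of
    [f] over [P] the indicator of [P] can be replaced by [r], its sum over nonzero scalar multiples;
    this spreading is what improves Cauchy-Schwarz. *)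
Let h x : rat := \sum_(y in P) (B x y == 0)%:R.
Let f x := h x - #|P|%:R / Q.
Let r x : rat := \sum_(l : F | l != 0) (l *: x \in P)%:R.

Let Q_gt0 : 0 < Q. Proof. by rewrite ltr0n. Qed.

Let Pneq0 y : y \in P -> y != 0.
Proof. by apply: contraTneq => ->. Qed.

Let sum_h : \sum_x h x = Q ^+ 3 * #|P|%:R.
Proof.
rewrite exchange_big /= mulr_natr -sumr_const; apply: eq_bigr => y yP.
by rewrite -natr_card card_orth1 ?Pneq0 // natrX.
Qed.

(** For fixed [y], at most [k] points [y'] of [P] are multiples of [y], each with [q^3] common
    orthogonal vectors; every other [y'] has at most [q^2]. *)
Let sum_h2 : \sum_x h x ^+ 2 <= Q ^+ 2 * #|P|%:R ^+ 2 + Q ^+ 3 * (k%:R * #|P|%:R).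
Proof.
have -> : \sum_x h x ^+ 2 = \sum_(y in P) \sum_(y' in P)
    #|[set x | (B x y == 0) && (B x y' == 0)]|%:R.
  rewrite (eq_bigr (fun x => \sum_(y in P) \sum_(y' in P)
      ((B x y == 0) && (B x y' == 0))%:R)); last first.
    move=> x _; rewrite expr2 big_distrl /=; apply: eq_bigr => y _.
    by rewrite big_distrr /=; apply: eq_bigr => y' _; rewrite -natrM mulnb.
  rewrite exchange_big /=; apply: eq_bigr => y _.
  rewrite exchange_big /=; apply: eq_bigr => y' _.
  by rewrite natr_card.
have -> : Q ^+ 2 * #|P|%:R ^+ 2 + Q ^+ 3 * (k%:R * #|P|%:R) =
    \sum_(y in P) (Q ^+ 2 * #|P|%:R + Q ^+ 3 * k%:R).
  by rewrite sumr_const -[LHS]mulr1 -mulr_natr; ring.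
apply: ler_sum => y yP; pose D := [set y' in P | [exists l, y' == l *: y]].
have cD : (#|D| <= k)%N.
  apply: leq_trans (Pk yP); rewrite -(card_in_imset (f := fun l => l *: y)).
    apply: subset_leq_card; apply/subsetP => y'; rewrite inE => /andP[y'P /existsP[l /eqP E]].
    by apply/imsetP; exists l => //; rewrite inE -E.
  move=> l l' _ _ /eqP; rewrite -subr_eq0 -scalerBl scaler_eq0 (negPf (Pneq0 yP)) orbF.
  by rewrite subr_eq0 => /eqP.
apply: (@le_trans _ _ (\sum_(y' in P) (Q ^+ 2 + Q ^+ 3 * (y' \in D)%:R))).
  apply: ler_sum => y' y'P.
  have [y'D|] := boolP (y' \in D).
    rewrite mulr1 ler_wpDl ?exprn_ge0 ?ler0n // -natrX ler_nat -(card_orth1 (Pneq0 yP)).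
    by apply: subset_leq_card; apply/subsetP => x; rewrite !inE => /andP[].
  rewrite inE y'P /= negb_exists => /forallP nD.
  by rewrite mulr0 addr0 -natrX ler_nat card_orth2 ?Pneq0.
rewrite big_split /= sumr_const mulr_natr lerD2l -big_distrr /=.
rewrite ler_wpM2l ?exprn_ge0 ?ler0n //.
have -> : \sum_(y' in P) (y' \in D)%:R = #|D|%:R :> rat.
  rewrite /D natr_card big_mkcond; apply: eq_bigr => y' _; rewrite inE.
  by case: (y' \in P).
by rewrite ler_nat.
Qed.

Let sum_f2 : \sum_x f x ^+ 2 <= Q ^+ 3 * (k%:R * #|P|%:R).
Proof.
have -> : \sum_x f x ^+ 2 = \sum_x h x ^+ 2 - 2 * (#|P|%:R / Q) * \sum_x h x
    + Q ^+ 4 * (#|P|%:R / Q) ^+ 2.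
  have -> : Q ^+ 4 * (#|P|%:R / Q) ^+ 2 = \sum_(x : X) (#|P|%:R / Q) ^+ 2.
    by rewrite sumr_const cardX -[RHS]mulr_natl natrX.
  rewrite [2 * _ * _]big_distrr /= -sumrB -big_split /=.
  by apply: eq_bigr => x _; rewrite /f; ring.
rewrite sum_h; apply: le_trans (_ : Q ^+ 2 * #|P|%:R ^+ 2 + Q ^+ 3 * (k%:R * #|P|%:R)
  - 2 * (#|P|%:R / Q) * (Q ^+ 3 * #|P|%:R) + Q ^+ 4 * (#|P|%:R / Q) ^+ 2 <= _).
  by rewrite !lerD2r.
by rewrite le_eqVlt; apply/orP; left; apply/eqP; field; rewrite lt0r_neq0.
Qed.

Let scale_sum (phi : X -> rat) : (forall l x, l != 0 -> phi (l *: x) = phi x) ->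
  \sum_x r x * phi x = (Q - 1) * \sum_(x in P) phi x.
Proof.
move=> phiZ.
have -> : (Q - 1) * \sum_(x in P) phi x = \sum_(l : F | l != 0) \sum_(x in P) phi x.
  rewrite sumr_const -[RHS]mulr_natl; congr (_ * _).
  have -> : #|[pred l : F | l != 0]| = q.-1.
    by rewrite -(cardC1 (0 : F)); apply: eq_card => l; rewrite !inE.
  by rewrite -subn1 natrB.
rewrite (eq_bigr (fun x => \sum_(l : F | l != 0) (l *: x \in P)%:R * phi x)); last first.
  by move=> x _; rewrite /r big_distrl.
rewrite exchange_big /=; apply: eq_bigr => l l0.
have lK : cancel ( *:%R l^-1 : X -> X) ( *:%R l) by move=> x; rewrite scalerA mulfV ?scale1r.
rewrite (reindex_inj (can_inj lK)) /= [RHS]big_mkcond; apply: eq_bigr => x _.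
rewrite lK phiZ ?invr_eq0 //; case: (x \in P); rewrite ?mul1r ?mul0r //.
Qed.

Lemma incidence_bound :
  (2 * q * #|[set t : X * X | [&& t.1 \in P, t.2 \in P & B t.1 t.2 == 0%R]]|
   <= 2 * #|P| ^ 2 + 3 * q ^ 2 * (k * #|P|))%N.
Proof.
have hZ l x : l != 0 -> h (l *: x) = h x.
  by move=> l0; apply: eq_bigr => y _; rewrite BZl mulf_eq0 (negPf l0).
have fZ l x : l != 0 -> f (l *: x) = f x by move=> l0; rewrite /f hZ.
have rZ l x : l != 0 -> r (l *: x) = r x.
  move=> l0; rewrite /r (reindex_inj (mulIf (invr_neq0 l0))) /=.
  apply: eq_big => [m|m _]; first by rewrite mulf_eq0 invr_eq0 (negPf l0) orbF.
  by rewrite scalerA divfK.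
have sum_r : \sum_x r x ^+ 2 <= (Q - 1) * (k%:R * #|P|%:R).
  rewrite (eq_bigr (fun x => r x * r x)) => [|x _]; last by rewrite expr2.
  rewrite scale_sum // ler_wpM2l ?subr_ge0 ?ler1n //.
  rewrite mulr_natr -sumr_const; apply: ler_sum => x xP.
  apply: le_trans (_ : #|[set l : F | l *: x \in P]|%:R <= _); last by rewrite ler_nat Pk.
  rewrite natr_card /r [leLHS]big_mkcond /=; apply: ler_sum => l _.
  by case: ifP => // _; rewrite ler0n.
have main : 2 * ((Q - 1) * \sum_(x in P) f x) <= 3 * Q * (Q - 1) * (k%:R * #|P|%:R).
  rewrite -scale_sum // big_distrr /=.
  (* The weight [Q] balances the two second moments, about [Q k |P|] for [r] and [Q^3 k |P|] for
     [f]. The constant 3 then comes from [Q (Q - 1) + Q^2 <= 3 Q (Q - 1)], valid for [Q >= 2]. *)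
  apply: le_trans (_ : \sum_x (Q * r x ^+ 2 + Q^-1 * f x ^+ 2) <= _).
    apply: ler_sum => x _; rewrite -subr_ge0.
    have -> : Q * r x ^+ 2 + Q^-1 * f x ^+ 2 - 2 * (r x * f x)
        = Q^-1 * (Q * r x - f x) ^+ 2 by field; rewrite lt0r_neq0.
    by rewrite mulr_ge0 ?invr_ge0 ?ler0n ?sqr_ge0.
  rewrite big_split /= -!big_distrr /=.
  have k0 : 0 <= k%:R * #|P|%:R :> rat by rewrite mulr_ge0 ?ler0n.
  have q2 : 2 <= Q by rewrite ler_nat card_finNzRing_gt1.
  have H1 : Q * \sum_x r x ^+ 2 <= Q * (Q - 1) * (k%:R * #|P|%:R).
    by rewrite -mulrA ler_wpM2l // ltW.
  have H2 : Q^-1 * \sum_x f x ^+ 2 <= Q ^+ 2 * (k%:R * #|P|%:R).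
    rewrite mulrC ler_pdivrMr //; apply: le_trans sum_f2 _.
    by rewrite le_eqVlt; apply/orP; left; apply/eqP; ring.
  apply: le_trans (lerD H1 H2) _.
  by rewrite -mulrDl ler_wpM2r //; nra.
have q1 : 0 < Q - 1 by rewrite subr_gt0 ltr1n card_finNzRing_gt1.
have {}main : 2 * \sum_(x in P) f x <= 3 * Q * (k%:R * #|P|%:R).
  rewrite -(ler_pM2l q1) mulrCA; apply: le_trans main _.
  by rewrite le_eqVlt; apply/orP; left; apply/eqP; ring.
set W := #|_|.
have WE : W%:R = \sum_(x in P) f x + #|P|%:R ^+ 2 / Q.
  have -> : \sum_(x in P) f x = \sum_(x in P) h x - #|P|%:R ^+ 2 / Q.
    by rewrite sumrB sumr_const -[_ *+ #|P|]mulr_natr; congr (_ - _); ring.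
  rewrite subrK /W natr_card.
  rewrite -(pair_big predT predT (fun x y => [&& x \in P, y \in P & B x y == 0]%:R : rat)) /=.
  rewrite [RHS]big_mkcond /=; apply: eq_bigr => x _; case: (x \in P) => /=; last first.
    by rewrite big1.
  by rewrite /h [RHS]big_mkcond /=; apply: eq_bigr => y _; case: (y \in P).
rewrite -(ler_nat rat) !(natrX, natrM, natrD) WE mulrDr mulrA.
have -> : 2 * Q * (#|P|%:R ^+ 2 / Q) = 2 * #|P|%:R ^+ 2 by field; rewrite lt0r_neq0.
rewrite addrC lerD2l -(ler_pM2l Q_gt0) in main *.
apply: le_trans (_ : _ <= Q * (2 * \sum_(x in P) f x)) (le_trans main _).
  by rewrite le_eqVlt; apply/orP; left; apply/eqP; ring.
by rewrite le_eqVlt; apply/orP; left; apply/eqP; ring.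
Qed.
End Incidence.

(** * The action on the plane *)

Section Vectors.
Variable F : fieldType.
Implicit Types (e f : 'cV[F]_2) (A : 'M[F]_2).

Lemma om0l e : om 0 e = 0. Proof. by rewrite /om !mxE; ring. Qed.

Lemma omD e f f' : om e (f + f') = om e f + om e f'.
Proof. by rewrite /om !mxE; ring. Qed.

Lemma omZ e a f : om e (a *: f) = a * om e f.
Proof. by rewrite /om !mxE; ring. Qed.

Lemma omC e f : om e f = - om f e.
Proof. by rewrite /om; ring. Qed.

Lemma omDl e e' f : om (e + e') f = om e f + om e' f.
Proof. by rewrite !(omC _ f) omD opprD. Qed.

Lemma omZl a e f : om (a *: e) f = a * om e f.
Proof. by rewrite !(omC _ f) omZ mulrN. Qed.

Lemma om_nondeg e : e != 0 -> exists f, om e f = 1.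
Proof.
move=> e0; pose mk a b : 'cV[F]_2 := \col_i (if i == 0 then a else b).
have omk a b : om e (mk a b) = e 0 0 * b - e 1 0 * a by rewrite /om !mxE.
have [e00|e00] := eqVneq (e 0 0) 0.
  have [e10|e10] := eqVneq (e 1 0) 0.
    by case/eqP: e0; apply: cV2P; rewrite mxE.
  by exists (mk (- (e 1 0)^-1) 0); rewrite omk mulr0 sub0r mulrN opprK mulfV.
by exists (mk 0 (e 0 0)^-1); rewrite omk mulr0 subr0 mulfV.
Qed.

Lemma om_eq0 e f : e != 0 -> om e f = 0 -> exists l, f = l *: e.
Proof.
move=> /om_nondeg[e']; rewrite /om => oe of0.
exists (f 0 0 * e' 1 0 - f 1 0 * e' 0 0); apply: cV2P; rewrite !mxE.
  apply: (lincomb2 (c := - f 0 0) (c' := e' 0 0)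
    (l := e 0 0 * e' 1 0 - e 1 0 * e' 0 0 - 1) (l' := e 0 0 * f 1 0 - e 1 0 * f 0 0)) => //.
    by rewrite oe subrr.
  by ring.
apply: (lincomb2 (c := - f 1 0) (c' := e' 1 0)
    (l := e 0 0 * e' 1 0 - e 1 0 * e' 0 0 - 1) (l' := e 0 0 * f 1 0 - e 1 0 * f 0 0)) => //.
  by rewrite oe subrr.
by ring.
Qed.

Lemma basis_expand e e' f : om e e' *: f = om f e' *: e + om e f *: e'.
Proof. by apply: cV2P; rewrite /om !mxE; ring. Qed.

Lemma mx_eq_on_basis A A' e e' : om e e' != 0 -> A *m e = A' *m e ->
  A *m e' = A' *m e' -> A = A'.
Proof.
move=> o0 E E'; have H f : A *m f = A' *m f.
  apply: (scalerI o0); rewrite -!linearZ /= basis_expand !linearD /= !linearZ /=.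
  by rewrite E E'.
apply/matrixP => i j; have /matrixP/(_ i 0) := H (delta_mx j 0).
by rewrite -!colE !mxE.
Qed.

Lemma om_transport e e' f f' : om e e' != 0 -> om f f' = om e e' ->
  exists A, [/\ \det A = 1, A *m e = f & A *m e' = f'].
Proof.
move=> o0 of_; pose c := om e e'.
exists (\matrix_(i < 2, j < 2) (if j == 0 then (f i 0 * e' 1 0 - f' i 0 * e 1 0) / c
   else (f' i 0 * e 0 0 - f i 0 * e' 0 0) / c)).
have c0 : e 0 0 * e' 1 0 - e 1 0 * e' 0 0 != 0 by [].
split.
- transitivity (om f f' / c); last by rewrite of_ mulfV.
  by rewrite !mx2E /= /c /om; field.
- by apply: cV2P; rewrite !mx2E /= /c /om; field.
- by apply: cV2P; rewrite !mx2E /= /c /om; field.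
Qed.
End Vectors.

(* A finite group identified with [SL_2(F_p)] through a faithful matrix map.
   Reasoning in an abstract carrier keeps unification away from the packed
   structures on ['GL_2['F_p]]. *)
Record sl2_model (p : nat) := Sl2Model {
  carrier :> finGroupType;
  rho : carrier -> 'M['F_p]_2;
  rhoM : forall g h, rho (g * h)%g = rho g *m rho h;
  rho_inj : injective rho;
  rho_det : forall g, \det (rho g) = 1;
  rho_lift : forall B, \det B = 1 -> exists g, rho g = B }.

(** * Second moment of the number of points of [E] sent into [F] *)

Section SecondMoment.
Variables (p : nat) (G : sl2_model p).
Hypothesis p_pr : prime p.
Local Notation V := 'cV['F_p]_2.
Implicit Types (e f : V) (g h : G) (E : {set V}).

Lemma rho_unit g : rho g \in unitmx.
Proof. by rewrite unitmxE rho_det unitr1. Qed.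

Lemma rho1 : rho (1%g : G) = 1%:M.
Proof.
by apply: (can_inj (mulmxK (rho_unit 1%g))); rewrite -rhoM mulg1 mul1mx.
Qed.

Lemma rhoV g : rho g^-1%g = invmx (rho g).
Proof.
by apply: (can_inj (mulmxK (rho_unit g))); rewrite -rhoM mulVg rho1 mulVmx ?rho_unit.
Qed.

Lemma mulVact g e : rho g^-1%g *m (rho g *m e) = e.
Proof. by rewrite mulmxA -rhoM mulVg rho1 mul1mx. Qed.

Lemma act_inj g : injective (fun e => rho g *m e).
Proof. by apply: (@can_inj _ _ _ (fun e : V => rho g^-1%g *m e)) => e; exact: mulVact. Qed.

Lemma act_eq0 g e : (rho g *m e == 0) = (e == 0).
Proof. by rewrite -{1}(mulmx0 _ (rho g)) (inj_eq (@act_inj g)). Qed.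

Lemma transport e e' f f' : om e e' != 0 -> om f f' = om e e' ->
  exists g, rho g *m e = f /\ rho g *m e' = f'.
Proof.
by move=> o0 /(om_transport o0)[B [/(rho_lift G)[g <-] Be Be']]; exists g.
Qed.

Lemma eq_on_basis g h e e' : om e e' != 0 -> rho g *m e = rho h *m e ->
  rho g *m e' = rho h *m e' -> g = h.
Proof. by move=> o0 E E'; apply/rho_inj/(mx_eq_on_basis o0). Qed.

Lemma om_rho g e f : om (rho g *m e) (rho g *m f) = om e f.
Proof. by rewrite om_mul rho_det mul1r. Qed.

Lemma card_V : #|V| = (p ^ 2)%N.
Proof. by rewrite card_mx card_Fp // muln1. Qed.

Lemma card_om e c : e != 0 -> #|[set f | om e f == c]| = p.
Proof.
move=> e0; have [e' oe] := om_nondeg e0.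
apply/eqP; rewrite -(eqn_pmul2l (prime_gt0 p_pr)) -{1}(card_Fp p_pr).
rewrite (@card_linear_fiber _ _ (om e) (omD e) e') ?card_V ?oe ?oner_eq0 //.
by move=> a; rewrite omZ oe.
Qed.

(** Complete [e] by [e'] with [om e e' = 1]: then [g] is determined by [g e'], which runs over the
    affine line [om f x = 1]. *)
Lemma card_send e f : e != 0 -> f != 0 -> #|[set g : G | rho g *m e == f]| = p.
Proof.
move=> e0 f0; have [e' oe] := om_nondeg e0.
transitivity #|[set x | om f x == 1]|; last exact: card_om.
set A := [set g : G | _].
have inj : {in A &, injective (fun g => rho g *m e')}.
  move=> g h; rewrite !inE => /eqP ge /eqP he E.
  by apply: (eq_on_basis (e := e) (e' := e')); rewrite ?oe ?oner_eq0 ?ge ?he.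
rewrite -(card_in_imset inj); apply: eq_card => x; rewrite [RHS]inE.
apply/imsetP/eqP => [[g]|ox].
  by rewrite inE => /eqP <- ->; rewrite om_rho.
have [||g [ge ge']] := @transport e e' f x; rewrite ?oe ?oner_eq0 //.
by exists g; rewrite // inE ge.
Qed.

Lemma card_sl2 : #|G| = ((p ^ 2).-1 * p)%N.
Proof.
pose e : V := const_mx 1; have e0 : e != 0.
  by apply/eqP => /matrixP/(_ 0 0); rewrite !mxE => /eqP; rewrite oner_eq0.
rewrite -sum1_card (partition_big (fun g : G => rho g *m e) (fun f => f != 0)) /=; last first.
  by move=> g _; rewrite act_eq0.
rewrite (eq_bigr (fun=> p)) => [|f f0]; last first.
  by rewrite -[RHS](card_send e0 f0) -sum1dep_card.
rewrite sum_nat_const; congr (_ * _)%N; rewrite -card_V -(cardC1 (0 : V)).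
by apply: eq_card => f; rewrite !inE.
Qed.

Definition hits E (F : {set V}) g := #|[set e in E | rho g *m e \in F]|.

Variables (E F : {set V}) (k : nat).
Hypotheses (E0 : 0 \notin E) (F0 : 0 \notin F) (Ek : lines_meet_at_most E k).

Let En0 e : e \in E -> e != 0. Proof. by apply: contraTneq => ->. Qed.
Let Fn0 e : e \in F -> e != 0. Proof. by apply: contraTneq => ->. Qed.

Lemma card_parallel e : e != 0 -> (#|[set e' in E | om e e' == 0%R]| <= k)%N.
Proof.
move=> e0; apply: leq_trans (Ek (L := <[e]>%VS) _); last by rewrite dim_vline e0.
apply: subset_leq_card; apply/subsetP => e'; rewrite !inE => /andP[-> /eqP oe] /=.
by have [l ->] := om_eq0 e0 oe; rewrite memvZ ?memv_line.
Qed.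

Let B (x y : 'cV['F_p]_(2 + 2)) :=
  om (usubmx x) (usubmx y) - om (dsubmx x) (dsubmx y).

Let P := [set col_mx u.1 u.2 | u in setX E F].

Let cardP : #|P| = (#|E| * #|F|)%N.
Proof.
rewrite card_imset ?cardsX // => -[a b] [c d] /= E1.
by have [-> ->] := eq_col_mx E1.
Qed.

Let PP x : reflect (usubmx x \in E /\ dsubmx x \in F) (x \in P).
Proof.
apply: (iffP imsetP) => [[[a b]]|[xE xF]].
  by rewrite in_setX => /andP[/= aE bF] ->; rewrite col_mxKu col_mxKd.
by exists (usubmx x, dsubmx x); rewrite ?in_setX ?xE ?xF //= vsubmxK.
Qed.

Lemma quadruples_bound :
  (2 * p * #|[set t : (V * V) * (V * V) | [&& t.1.1 \in E, t.1.2 \in E,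
      t.2.1 \in F, t.2.2 \in F & om t.1.1 t.1.2 == om t.2.1 t.2.2]]|
   <= 2 * (#|E| * #|F|) ^ 2 + 3 * p ^ 2 * (k * (#|E| * #|F|)))%N.
Proof.
rewrite -cardP; set Y := [set t | _].
have uD (x y : 'cV['F_p]_(2 + 2)) : usubmx (x + y) = usubmx x + usubmx y by rewrite linearD.
have dD (x y : 'cV['F_p]_(2 + 2)) : dsubmx (x + y) = dsubmx x + dsubmx y by rewrite linearD.
have key : (2 * #|'F_p| * #|[set t : 'cV['F_p]_(2 + 2) * 'cV['F_p]_(2 + 2) |
    [&& t.1 \in P, t.2 \in P & B t.1 t.2 == 0%R]]|
    <= 2 * #|P| ^ 2 + 3 * #|'F_p| ^ 2 * (k * #|P|))%N.
  apply: incidence_bound.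
  - by move=> x x' y; rewrite /B uD dD !omDl opprD addrACA.
  - by move=> a x y; rewrite /B !linearZ /= !omZl; ring.
  - by move=> x y y'; rewrite /B uD dD !omD opprD addrACA.
  - by move=> a x y; rewrite /B !linearZ /= !omZ; ring.
  - move=> y y0; have [u0|/om_nondeg[e oe]] := eqVneq (usubmx y) 0.
      have /om_nondeg[e oe] : dsubmx y != 0.
        by apply: contraNneq y0 => d0; rewrite -[y]vsubmxK u0 d0 col_mx0.
      exists (col_mx 0 e); rewrite /B col_mxKu col_mxKd om0l omC oe sub0r opprK.
      exact: oner_neq0.
    exists (col_mx e 0); rewrite /B col_mxKu col_mxKd om0l omC oe subr0 oppr_eq0.
    exact: oner_neq0.
  - by rewrite card_mx card_Fp // muln1.
  - by apply/PP; rewrite linear0; case=> /En0; rewrite eqxx.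
  (* A multiple of [x] is determined by its component in [E], which is nonzero, so lines through the
     origin of the product inherit the bound [k] from [E]. *)
  - move=> x /PP[xE xF]; apply: leq_trans (card_parallel (En0 xE)).
    have inj : injective (fun l => l *: usubmx x).
      move=> l l' /eqP; rewrite -subr_eq0 -scalerBl scaler_eq0 (negPf (En0 xE)) orbF.
      by rewrite subr_eq0 => /eqP.
    rewrite -(card_imset _ inj); apply: subset_leq_card; apply/subsetP => _ /imsetP[l + ->].
    rewrite !inE => /PP[]; rewrite linearZ /= => -> _; rewrite omZ /om; apply/eqP; ring.
rewrite !card_Fp // in key; apply: leq_trans key.
rewrite leq_pmul2l ?muln_gt0 ?prime_gt0 //.
pose h (t : (V * V) * (V * V)) := (col_mx t.1.1 t.2.1, col_mx t.1.2 t.2.2).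
rewrite -(card_imset (f := h)); last first.
  move=> [[a b] [c d]] [[a' b'] [c' d']] [] /= E1 E2.
  by have [-> ->] := eq_col_mx E1; have [-> ->] := eq_col_mx E2.
apply: subset_leq_card; apply/subsetP => _ /imsetP[[[a b] [c d]] + ->].
rewrite !inE /= => /and5P[aE bE cF dF /eqP o].
apply/and3P; split; try by apply/PP; rewrite col_mxKu col_mxKd.
by rewrite /B !col_mxKu !col_mxKd o subrr.
Qed.

Lemma card_hit e : e != 0 -> #|[set g : G | rho g *m e \in F]| = (p * #|F|)%N.
Proof.
move=> e0; rewrite -sum1dep_card (partition_big (fun g => rho g *m e) (mem F)) //=.
rewrite mulnC -sum_nat_const; apply: eq_bigr => f fF.
rewrite -[RHS](card_send e0 (Fn0 fF)) -sum1dep_card; apply: eq_bigl => g.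
by case: eqP => [->|]; rewrite ?fF ?andbF.
Qed.

Lemma sum_hits : (\sum_(g : G) hits E F g = p * (#|E| * #|F|))%N.
Proof.
rewrite mulnCA -sum_nat_const.
rewrite (eq_bigr (fun g => \sum_(e in E) (rho g *m e \in F)))%N; last first.
  move=> g _; rewrite /hits -sum1dep_card big_mkcondr /=.
  by apply: eq_bigr => e _; case: (_ \in F).
rewrite exchange_big /=; apply: eq_bigr => e eE.
rewrite -(card_hit (En0 eE)) -sum1dep_card [RHS]big_mkcond /=.
by apply: eq_bigr => g _; case: (_ \in F).
Qed.

(** An independent pair [(e, e')] and its image determine [g], giving a quadruple with equal areas.
    There are at most [k |E|] dependent pairs, each satisfied by at most [p |F|] elements [g]. *)
Lemma sum_hits2 : (\sum_(g : G) hits E F g ^ 2 <=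
  #|[set t : (V * V) * (V * V) | [&& t.1.1 \in E, t.1.2 \in E,
      t.2.1 \in F, t.2.2 \in F & om t.1.1 t.1.2 == om t.2.1 t.2.2]]|
  + p * k * (#|E| * #|F|))%N.
Proof.
pose hit2 g (t : V * V) := (rho g *m t.1 \in F) && (rho g *m t.2 \in F).
have -> : (\sum_(g : G) hits E F g ^ 2 =
    \sum_(t in setX E E) #|[set g : G | hit2 g t]|)%N.
  rewrite (eq_bigr (fun g => \sum_(t in setX E E) hit2 g t))%N; last first.
    move=> g _; rewrite -[(_ ^ 2)%N]cardsX -sum1_card big_mkcond [RHS]big_mkcond /=.
    by apply: eq_bigr => -[e e'] _; rewrite !inE /hit2 /=; case: (e \in E); case: (e' \in E);
       rewrite ?andbF //=; case: (_ \in F).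
  rewrite exchange_big; apply: eq_bigr => t _.
  by rewrite -sum1dep_card [RHS]big_mkcond /=; apply: eq_bigr => g _; case: (hit2 _ _).
pose Y2 (t : V * V) := [set u in setX F F | om t.1 t.2 == om u.1 u.2].
apply: (@leq_trans (\sum_(t in setX E E) (#|Y2 t| + (om t.1 t.2 == 0%R) * (p * #|F|)))).
  apply: leq_sum => -[e e']; rewrite in_setX => /= /andP[eE e'E].
  have [_|o0] := eqVneq (om e e') 0.
    rewrite mul1n -(card_hit (En0 eE)); apply: leq_trans (leq_addl _ _).
    by apply: subset_leq_card; apply/subsetP => g; rewrite !inE => /andP[].
  rewrite mul0n addn0 -(card_in_imset (f := fun g => (rho g *m e, rho g *m e'))).
    apply: subset_leq_card; apply/subsetP => _ /imsetP[g + ->].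
    by rewrite inE => /andP[/= H H']; rewrite !inE /= H H' om_rho eqxx.
  by move=> g h _ _ [] /(eq_on_basis o0); apply.
rewrite big_split /=; apply: leq_add.
  rewrite -[leqRHS]sum1dep_card big_mkcond [leqRHS]big_mkcond.
  rewrite -[leqRHS](pair_big predT predT (fun t u =>
     if [&& t.1 \in E, t.2 \in E, u.1 \in F, u.2 \in F & om t.1 t.2 == om u.1 u.2] then 1 else 0)%N) /=.
  apply: leq_sum => -[e e'] _; rewrite in_setX /=; case: (e \in E) => //=; case: (e' \in E) => //=.
  rewrite -sum1dep_card big_mkcond; apply: leq_sum => -[f f'] _; rewrite !inE /=.
  by case: (f \in F); case: (f' \in F).
rewrite -big_distrl /=.
have -> : (p * k * (#|E| * #|F|) = (#|E| * k) * (p * #|F|))%N by ring.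
rewrite leq_mul2r; apply/orP; right.
rewrite -[leqRHS]sum_nat_const (eq_bigl (fun t => (t.1 \in E) && (t.2 \in E))); last first.
  by move=> t; rewrite inE.
rewrite -(pair_big (mem E) (mem E) (fun e e' => (om e e' == 0%R) : nat)) /=.
apply: leq_sum => e eE; apply: leq_trans (card_parallel (En0 eE)).
rewrite -sum1dep_card big_mkcondr /= leq_eqVlt; apply/orP; left; apply/eqP.
by apply: eq_bigr => e' _; case: (_ == _).
Qed.

Lemma card_sl2_le : (#|G| <= p ^ 3)%N.
Proof. by rewrite card_sl2 [(p ^ 3)%N]expnSr leq_mul2r leq_pred orbT. Qed.

(** The main terms [w^2 / p] cancel as [1 - 2 + 1]; what remains is [(3/2 + 1) p k w], with [3/2]
    from the incidences and [1] from dependent pairs. The centre is computed with [p^3] in place of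
    [|G|], harmless since [|G| <= p^3]. *)
Lemma hits_variance :
  \sum_(g : G) ((hits E F g)%:R - (#|E| * #|F|)%:R / p%:R ^+ 2) ^+ 2
  <= 3 * p%:R * k%:R * (#|E| * #|F|)%:R :> rat.
Proof.
set w : rat := (#|E| * #|F|)%:R; set q : rat := p%:R; set c := w / q ^+ 2.
have q0 : 0 < q by rewrite ltr0n prime_gt0.
have w0 : 0 <= w by rewrite ler0n.
have k0 : 0 <= k%:R :> rat by rewrite ler0n.
have -> : \sum_(g : G) ((hits E F g)%:R - c) ^+ 2 =
   (\sum_(g : G) hits E F g ^ 2)%:R - 2 * c * (\sum_(g : G) hits E F g)%:R
   + #|G|%:R * c ^+ 2.
  have -> : #|G|%:R * c ^+ 2 = \sum_(g : G) c ^+ 2.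
    by rewrite sumr_const mulr_natl.
  rewrite !natr_sum big_distrr /= -sumrB -big_split /=.
  by apply: eq_bigr => g _; rewrite natrX; ring.
rewrite sum_hits natrM -/w -/q.
have Y2 := quadruples_bound; have N2 := sum_hits2; set Y := #|_| in Y2 N2.
have {}N2 : (\sum_(g : G) hits E F g ^ 2)%:R <= Y%:R + q * k%:R * w :> rat.
  by rewrite -natrM -natrM -natrD ler_nat.
have {}Y2 : 2 * q * Y%:R <= 2 * w ^+ 2 + 3 * q ^+ 2 * (k%:R * w).
  by rewrite /q /w -natrX -[X in _ <= _ + _ * X ^+ 2 * _]/q -!(natrX, natrM, natrD) ler_nat.
have {}Y2 : Y%:R <= w ^+ 2 / q + 3 / 2 * q * k%:R * w.
  rewrite -(ler_pM2l q0) -(ler_pM2l (x := 2)) // mulrA; apply: le_trans Y2 _.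
  by rewrite le_eqVlt; apply/orP; left; apply/eqP; field; rewrite lt0r_neq0.
have S3 : #|G|%:R * c ^+ 2 <= w ^+ 2 / q.
  apply: le_trans (_ : q ^+ 3 * c ^+ 2 <= _).
    by rewrite ler_wpM2r ?sqr_ge0 // -natrX ler_nat card_sl2_le.
  by rewrite /c le_eqVlt; apply/orP; left; apply/eqP; field; rewrite lt0r_neq0.
have E2 : 2 * c * (q * w) = 2 * (w ^+ 2 / q) by rewrite /c; field; rewrite lt0r_neq0.
have kw : 0 <= q * k%:R * w by rewrite !mulr_ge0 // ltW.
rewrite E2; move: N2 Y2 S3 kw; set X1 := (\sum_(g : G) _)%:R; set X2 := _ / q.
set X3 := _ * c ^+ 2; move: X1 X2 X3 => X1 X2 X3 H1 H2 H3 H4.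
nra.
Qed.

(** Chebyshev: the threshold [a / b] is at least twice the mean, so every [g] in [A] deviates by at
    least [a / (2 b)]; [12 = 3 * 4]. *)
Lemma popular_bound (A : {set G}) a b : (b > 0)%N ->
  (forall g, g \in A -> (a <= b * hits E F g)%N) ->
  (2 * b * (#|E| * #|F|) <= a * p ^ 2)%N ->
  (#|A| * a ^ 2 <= 12 * b ^ 2 * (p * k * (#|E| * #|F|)))%N.
Proof.
move=> b0 Ah ab; have V0 := hits_variance.
set w : rat := (#|E| * #|F|)%:R in V0; set q : rat := p%:R in V0; set c := w / q ^+ 2 in V0.
have q0 : 0 < q by rewrite ltr0n prime_gt0.
have B0 : 0 < b%:R :> rat by rewrite ltr0n.
pose m : rat := a%:R / (2 * b%:R).
have mc : c <= m.
  rewrite /c /m ler_pdivrMr ?exprn_gt0 // mulrAC ler_pdivlMr ?mulr_gt0 //.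
  by rewrite mulrC /w /q -natrX -!natrM ler_nat.
have : #|A|%:R * m ^+ 2 <= 3 * q * k%:R * w.
  apply: le_trans V0; rewrite mulr_natl -sumr_const.
  rewrite [leRHS](bigID (mem A)) /=.
  apply: ler_wpDr; first by apply: sumr_ge0 => g _; rewrite sqr_ge0.
  apply: ler_sum => g gA; have := Ah g gA; rewrite -(ler_nat rat) natrM => H.
  have m0 : 0 <= m by rewrite /m divr_ge0 ?mulr_ge0 ?ler0n.
  have H2 : 2 * m <= (hits E F g)%:R.
    rewrite -(ler_pM2l B0); apply: le_trans H; rewrite /m le_eqVlt; apply/orP; left.
    by apply/eqP; field; rewrite lt0r_neq0.
  by rewrite ler_sqr ?nnegrE //; lra.
rewrite -(ler_pM2l (x := 4 * b%:R ^+ 2)) ?mulr_gt0 ?exprn_gt0 //.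
rewrite -(ler_nat rat) => H; apply: le_trans (le_trans H _).
  rewrite natrM natrX le_eqVlt; apply/orP; left; apply/eqP; rewrite /m.
  by field; rewrite lt0r_neq0.
rewrite /w /q !(natrX, natrM) le_eqVlt; apply/orP; left; apply/eqP; ring.
Qed.
End SecondMoment.

(** * Tori *)

Lemma card_le_fibers (T U : finType) (f : T -> U) (A : {set T}) (X : {set U}) r :
  (forall x, x \in A -> f x \in X) ->
  (forall y, y \in X -> #|[set x in A | f x == y]| <= r)%N -> (#|A| <= #|X| * r)%N.
Proof.
move=> fX fr; rewrite -sum1_card (partition_big f (mem X)) //=.
rewrite -sum_nat_const; apply: leq_sum => y yX; apply: leq_trans (fr y yX).
by rewrite -sum1dep_card.
Qed.

Lemma card_le2 (T U : finType) (f : T -> U) (Y : {set T}) :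
  {in Y &, injective f} ->
  (forall y0, y0 \in Y -> exists c, forall y, y \in Y -> f y = f y0 \/ f y = c) ->
  (#|Y| <= 2)%N.
Proof.
move=> inj H; have [->|[y0 y0Y]] := set_0Vmem Y; first by rewrite cards0.
have [c Hc] := H _ y0Y; rewrite -(card_in_imset inj).
apply: leq_trans (_ : #|[set f y0; c]| <= 2)%N; last by rewrite cards2; case: (_ != _).
apply: subset_leq_card; apply/subsetP => _ /imsetP[y yY ->].
by rewrite !inE; case: (Hc y yY) => ->; rewrite eqxx ?orbT.
Qed.

Lemma nat_sqrt N : exists b, (b ^ 2 <= N < b.+1 ^ 2)%N.
Proof.
elim: N => [|N [b /andP[b1 b2]]]; first by exists 0%N.
have [Nb|Nb] := ltnP N.+1 (b.+1 ^ 2); first by exists b; rewrite Nb andbT ltnW.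
by exists b.+1; rewrite Nb /=; nia.
Qed.

(** * Powers of a symmetric set containing the identity *)

Section SetPowers.
Variables (gT : finGroupType) (A : {set gT}).
Hypotheses (A1 : (1 \in A)%g) (AV : (A^-1)%g = A).
Local Open Scope group_scope.

Lemma mem_powM m n x y : x \in A ^+ m -> y \in A ^+ n -> x * y \in A ^+ (m + n).
Proof. by move=> xA yA; rewrite expgD mem_mulg. Qed.

Lemma pow1 n : 1 \in A ^+ n.
Proof.
by elim: n => [|n IH]; rewrite ?expg0 ?set11 // expgS -(mulg1 1) mem_mulg.
Qed.

Lemma pow_sub m n : (m <= n)%N -> A ^+ m \subset A ^+ n.
Proof.
move=> mn; apply/subsetP => x xA; rewrite -(subnKC mn) -(mulg1 x).
exact: mem_powM (pow1 _).
Qed.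

Lemma mem_pow1 x : x \in A -> x \in A ^+ 1. Proof. by rewrite expg1. Qed.

Lemma mem_powV n x : x \in A ^+ n -> x^-1 \in A ^+ n.
Proof.
elim: n x => [x|n IH x]; first by rewrite expg0 => /set1P ->; rewrite invg1 set11.
rewrite expgS => /mulsgP[a y aA yA ->]; rewrite invMg -expgS expgSr mem_mulg ?IH //.
by rewrite -AV inE invgK.
Qed.

Lemma mem_invA x : x \in A -> x^-1 \in A.
Proof. by move=> xA; rewrite -AV inE invgK. Qed.

(** Multiply [c] in [A^m] and [C] by [x] in [A]: two pairs with the same product have
    [c0^-1 c = x0 x^-1], which lies in both [A^2] and [C]. So [A^2] already sees the part of [C] met
    by higher powers. *)
Lemma card_pow_conj (C : {group gT}) m :
  (#|A ^+ m :&: C| * #|A| <= #|A ^+ m.+1| * #|A ^+ 2 :&: C|)%N.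
Proof.
rewrite -cardsX; apply: (card_le_fibers (f := fun t => t.1 * t.2)) => [[c x]|y _].
  by rewrite !inE /= => /andP[/andP[cA _] xA]; rewrite expgSr mem_mulg.
set Y := [set _ in _ | _]; have [->|[[c0 x0]]] := set_0Vmem Y; first by rewrite cards0.
rewrite !inE /= => /andP[/andP[/andP[_ c0C] x0A] /eqP y0].
rewrite -(card_in_imset (f := fun t => c0^-1 * t.1)); last first.
  move=> [c x] [c' x']; rewrite !inE /= => /andP[_ /eqP E] /andP[_ /eqP E'] /mulgI Ec.
  by move: E'; rewrite -E -Ec => /mulgI ->.
apply: subset_leq_card; apply/subsetP => _ /imsetP[[c x] + ->].
rewrite !inE /= => /andP[/andP[/andP[_ cC] xA] /eqP E].
have -> : c0^-1 * c = x0 * x^-1.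
  by apply: (mulgI c0); rewrite mulKVg mulgA y0 -E mulgK.
rewrite mem_mulg ?mem_invA //= -[x0 * _]mul1g.
by rewrite -(mulVg c0) -mulgA groupM ?groupV // mulgA y0 -E mulgK.
Qed.
End SetPowers.

Section Product.
Variables (p : nat) (G : sl2_model p).
Hypotheses (p_pr : prime p) (p_gt2 : (2 < p)%N).
Local Notation V := 'cV['F_p]_2.
Implicit Types (e f : V) (g h x y z w : G).

Definition tr (g : G) : 'F_p := \tr (rho g).
(** Traces 2 and -2 are those with a repeated eigenvalue. Trace 0 is removed as well because
    [third_factor] cancels the trace. *)
Definition regular (g : G) := [&& tr g != 0, tr g != 2%:R & tr g != - 2%:R].

Lemma tr_mulC g h : tr (g * h)%g = tr (h * g)%g.
Proof. by rewrite /tr !rhoM mxtrace_mulC. Qed.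

Lemma trV g : tr g^-1%g = tr g.
Proof. by rewrite /tr rhoV tr_invmx_det1 ?rho_det. Qed.

Lemma trJ g h : tr (g ^ h)%g = tr g.
Proof. by rewrite conjgE tr_mulC mulgK. Qed.

Lemma rhoV_tr g : rho g^-1%g = (tr g)%:M - rho g.
Proof. by rewrite rhoV invmx_det1 ?rho_det. Qed.

Lemma two_neq0 : (2%:R : 'F_p) != 0.
Proof.
rewrite -(dvdn_pcharf (pchar_Fp p_pr)).
by apply/negP => /(dvdn_leq (isT : 0 < 2)%N); lia.
Qed.

Lemma scalar_tr g : is_scalar_mx (rho g) -> tr g = 2%:R \/ tr g = - 2%:R.
Proof.
move=> /is_scalar_mxP[c gc]; have := rho_det g; rewrite /tr gc det_scalar mxtrace_scalar.
move/eqP; rewrite -subr_eq0 -[X in _ - X](expr1n _ 2) subr_sqr mulf_eq0 subr_eq0 addr_eq0.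
by case/orP => /eqP ->; [left|right]; rewrite ?mulNrn.
Qed.

Lemma regular_nonscalar g : regular g -> ~~ is_scalar_mx (rho g).
Proof.
move=> /and3P[_ t2 t2']; apply/negP => /scalar_tr[] E.
  by rewrite E eqxx in t2.
by rewrite E eqxx in t2'.
Qed.

Lemma regular_disc g : regular g ->
  \tr (rho g) ^+ 2 != 4%:R * \det (rho g).
Proof.
move=> /and3P[_ t2 t2']; rewrite rho_det mulr1 -subr_eq0.
have -> : (4%:R : 'F_p) = 2%:R ^+ 2 by rewrite -natrX.
by rewrite subr_sqr mulf_eq0 subr_eq0 addr_eq0 negb_or t2.
Qed.

Lemma commute_mx g h : commute g h -> rho g *m rho h = rho h *m rho g.
Proof. by move=> gh; rewrite -!rhoM gh. Qed.

Lemma mx_commute g h : rho g *m rho h = rho h *m rho g -> commute g h.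
Proof. by move=> gh; apply: rho_inj; rewrite !rhoM. Qed.

Lemma cent_regular z z' : regular z -> regular z' ->
  z' \in 'C[z]%g -> 'C[z']%g = 'C[z]%g.
Proof.
have sub x y : regular y -> y \in 'C[x]%g -> 'C[y]%g \subset 'C[x]%g.
  move=> yr /cent1P xy; apply/subsetP => g /cent1P gy; apply/cent1P/mx_commute.
  have [a [b ->]] := comm_nonscalar (regular_nonscalar yr) (commute_mx gy).
  rewrite mulmxDl mulmxDr -scalemxAl -scalemxAr (commute_mx xy).
  by rewrite mul_scalar_mx mul_mx_scalar.
move=> zr z'r z'C; apply/eqP; rewrite eqEsubset !sub //.
by apply/cent1P; apply: commute_sym; apply/cent1P.
Qed.

Lemma card_cent_tr z s : regular z ->
  (#|[set y in 'C[z]%g | tr y == s]| <= 2)%N.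
Proof.
move=> zr; apply: (@card_le2 _ _ (fun g : G => rho g)) => [g h _ _|y0].
  exact: rho_inj.
rewrite inE => /andP[/cent1P/commute_mx y0C /eqP t0].
exists ((\tr (rho y0))%:M - rho y0) => y.
rewrite inE => /andP[/cent1P/commute_mx yC /eqP t].
apply: (centralizer_trace two_neq0 (regular_nonscalar zr) (regular_disc zr)) => //.
  by rewrite -/(tr y) t -t0.
by rewrite !rho_det.
Qed.

Lemma card_cent z : regular z -> (#|'C[z]%g| <= 2 * p)%N.
Proof.
move=> zr; apply: (@leq_trans (#|[set: 'F_p]| * 2)%N); last by rewrite cardsT card_Fp // mulnC.
apply: (card_le_fibers (f := tr)) => [x _|s _]; rewrite ?inE //; exact: card_cent_tr.
Qed.

(** Six is three excluded traces times two elements of the torus for each. *)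
Lemma card_singular (Y : {set G}) z : regular z -> Y \subset 'C[z]%g ->
  (#|Y| <= #|[set y in Y | regular y]| + 6)%N.
Proof.
move=> zr Yz; rewrite -(cardsID [set y | regular y] Y) leq_add //.
  by apply: subset_leq_card; apply/subsetP => y; rewrite !inE.
apply: (@leq_trans (#|[set 0%R; 2%:R; - 2%:R : 'F_p]| * 2)%N); last first.
  rewrite -[6%N]/(3 * 2)%N leq_mul2r /=; apply: leq_trans (leq_card_setU _ _) _.
  by rewrite cards2 cards1; case: (_ != _).
apply: (card_le_fibers (f := tr)) => [y|s _].
  rewrite !inE => /andP[yr _]; apply: contraR yr => /norP[/norP[t1 t2] t3].
  by rewrite /regular t1 t2.
apply: leq_trans (card_cent_tr s zr); apply: subset_leq_card; apply/subsetP => y.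
by move=> /setIdP[/setDP[/(subsetP Yz) yC _] yt]; rewrite inE yC.
Qed.
End Product.

(** * Growth of generating sets *)

Section ProductTheorem.
Variables (p : nat) (G : sl2_model p).
Hypotheses (p_pr : prime p) (p_gt2 : (2 < p)%N).
Local Notation V := 'cV['F_p]_2.
Implicit Types (e f : V) (g h x y z w : G).
Variable A : {set G}.
Hypotheses (A1 : (1 \in A)%g) (AV : (A^-1)%g = A) .
Hypothesis Agen : forall H : {group G}, H \proper [set: G] -> ~ A \subset H.
Variable M : nat.
(** [17 = 8 + 1 + 8] accommodates [x a y^-1] with [x], [y] in [A^8], the longest product formed.
    [64] lets [M^2] absorb [16^3 = 64^2]. *)
Hypotheses (M64 : (64 <= M)%N) (A17 : (#|(A ^+ 17)%g| <= M * #|A|)%N).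

Lemma card_pow_le n : (n <= 17)%N -> (#|(A ^+ n)%g| <= M * #|A|)%N.
Proof. by move=> n17; apply: leq_trans A17; apply/subset_leq_card/pow_sub. Qed.

(** The stabilizer of the line of [e] is a proper subgroup, so [A] is not contained in it. *)
Lemma exists_moving e : e != 0 -> exists2 a, a \in A & om e (rho a *m e) != 0.
Proof.
move=> e0; pose H := [set g : G | om e (rho g *m e) == 0].
have Hg : group_set H.
  apply/group_setP; split=> [|x y].
    by rewrite inE rho1 mul1mx /om mulrC subrr eqxx.
  rewrite !inE => /eqP xe /eqP ye.
  have [l El] := om_eq0 e0 ye; have [m Em] := om_eq0 e0 xe.
  by rewrite rhoM -mulmxA El linearZ /= Em !omZ /om [e 1 0 * _]mulrC subrr !mulr0.
have HS : Group Hg \proper [set: G].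
  apply/properP; split; first exact: subsetT.
  have [e' oe] := om_nondeg e0.
  have [||g [ge _]] := @transport p G e e' e' (- e).
  - by rewrite oe oner_eq0.
  - by rewrite -scaleN1r omZ mulN1r -omC.
  by exists g; rewrite ?inE // ge oe oner_eq0.
have [a aA aH] : exists2 a, a \in A & a \notin H.
  by apply/subsetPn/negP; exact: (Agen HS).
by exists a => //; move: aH; rewrite inE.
Qed.

Lemma gen_full : <<A>>%g = [set: G].
Proof.
apply/eqP; rewrite eqEsubset subsetT /=; apply: contraT => nS.
by case: (@Agen <<A>>%G); rewrite ?properE ?subsetT // subset_gen.
Qed.

(** Otherwise the whole group would be abelian; but the rotation [e -> e' -> -e] and the shear
    fixing [e] with [e' -> e' + e] do not commute. *)
Lemma exists_noncommuting : exists g h, [/\ g \in A, h \in A & ~ commute g h].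
Proof.
suff /subsetPn[g gA /centP nC] : ~~ abelian A.
  have /exists_inP[h hA gh] : [exists h in A, (g * h != h * g)%g].
    apply: contraT; rewrite negb_exists_in => /forall_inP H; case: nC => h hA.
    by apply/eqP/negPn; exact: H.
  by exists g, h; split=> // /eqP; rewrite (negPf gh).
apply/negP => abA; have abG : abelian <<A>> by rewrite abelian_gen.
pose e : V := const_mx 1; have e0 : e != 0.
  by apply/eqP => /matrixP/(_ 0 0); rewrite !mxE => /eqP; rewrite oner_eq0.
have [e' oe] := om_nondeg e0.
have oe0 : om e e' != 0 by rewrite oe oner_eq0.
have [|g [ge ge']] := @transport p G e e' e' (- e) oe0.
  by rewrite -scaleN1r omZ mulN1r -omC.
have [|u [ue ue']] := @transport p G e e' e (e' + e) oe0.
  by rewrite omD /om [e 1 0 * e 0 0]mulrC subrr addr0.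
have gu : commute g u.
  by have := subsetP abG g; rewrite gen_full => /(_ (in_setT g))/centP; apply; rewrite inE.
have := congr1 (fun g => rho g *m e) gu.
rewrite !rhoM -!mulmxA ue ge ue' => /eqP; rewrite -subr_eq0 opprD addrA subrr sub0r.
by rewrite oppr_eq0 (negPf e0).
Qed.

(** The integer square root of [M |A|]. *)
Variable b : nat.
Hypotheses (b_le : (b ^ 2 <= M * #|A|)%N) (b_gt : (M * #|A| < b.+1 ^ 2)%N).

(* The map [(x, y) |-> x a y^-1] is injective on pairs from the fiber as soon as
   [a] moves the line of [e]. *)
Lemma vector_fiber n e v : (n <= 8)%N -> e != 0 ->
  (#|[set x in (A ^+ n)%g | rho x *m e == v]| <= b)%N.
Proof.
move=> n8 e0; set Y := [set _ in _ | _]; rewrite -ltnS -(ltn_exp2r _ _ (isT : 0 < 2)%N).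
apply: leq_ltn_trans b_gt; apply: leq_trans A17.
have [a aA ae] := exists_moving e0.
rewrite -[(_ ^ 2)%N]cardsX -(card_in_imset (f := fun t => t.1 * a * t.2^-1)%g).
  apply: subset_leq_card; apply/subsetP => _ /imsetP[[x y] + ->].
  rewrite !inE /= => /andP[/andP[xA _] /andP[yA _]].
  have s8 := subsetP (pow_sub A1 n8).
  exact: (mem_powM (m := 9) (mem_powM (s8 _ xA) (mem_pow1 aA)) (mem_powV AV (s8 _ yA))).
move=> [x y] [x' y']; rewrite !inE /= => /andP[/andP[xA /eqP xe] /andP[yA /eqP ye]].
move=> /andP[/andP[x'A /eqP x'e] /andP[y'A /eqP y'e]] E.
have fixE (u u' : G) : rho u *m e = v -> rho u' *m e = v -> rho (u'^-1 * u)%g *m e = e.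
  by move=> ue u'e; rewrite rhoM -mulmxA ue -u'e mulVact.
have E2 : (x'^-1 * x = a * (y'^-1 * y) * a^-1)%g.
  apply: (mulgI x'); rewrite mulKVg; apply: (mulIg (a * y^-1))%g.
  by rewrite mulgA E !mulgA mulgKV mulgK.
have X1 : (x'^-1 * x = 1)%g.
  apply: (eq_on_basis ae); first by rewrite fixE // rho1 mul1mx.
  rewrite E2 rho1 mul1mx mulmxA -rhoM mulgKV rhoM -mulmxA.
  by rewrite (fixE _ _ ye y'e).
have xx : x' = x by rewrite -[x]mul1g -(mulgV x') -mulgA X1 mulg1.
congr (_, _) => //; move: E; rewrite xx => /mulgI/invg_inj -> //.
Qed.


(** If [x] differs from [w], then [x - w] is traceless and singular, so [x] and [w] agree on a
    vector [e], which is moreover an eigenvector of [w]. As [w] has at most two eigenlines,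
    [vector_fiber] gives [2 b]; the last unit is [w] itself. *)
Lemma unipotent_fiber n w : (n <= 8)%N -> regular w ->
  (#|[set x in (A ^+ n)%g | (tr x == tr w) && (tr (x * w^-1)%g == 2%:R)]| <= (2 * b).+1)%N.
Proof.
move=> n8 wr; set Y := [set _ in _ | _].
have eig x : x \in Y -> x != w -> exists2 e : V, e != 0 &
    rho x *m e = rho w *m e /\ om e (rho w *m e) = 0.
  rewrite inE => /and3P[xA /eqP tx /eqP txw] xw.
  set W : 'M['F_p]_2 := rho w; set X : 'M['F_p]_2 := rho x.
  have dX : \det X = 1 by exact: rho_det.
  have dW : \det W = 1 by exact: rho_det.
  have tX : \tr X = \tr W by [].
  have tXW : \tr (X *m ((\tr W)%:M - W)) = 2%:R.
    by rewrite -txw /tr rhoM rhoV_tr.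
  have n0 : X - W != 0 by rewrite subr_eq0 (inj_eq (@rho_inj p G)).
  have dn : \det (X - W) = 0.
    transitivity (\det X + \det W - \tr (X *m ((\tr W)%:M - W))).
      by rewrite !mx2E /=; ring.
    by rewrite dX dW tXW -[1 + 1]/(2%:R) subrr.
  have tn : \tr (X - W) = 0 by rewrite linearB /= tX subrr.
  have tWn : \tr (W *m (X - W)) = 0.
    transitivity (\tr X * \tr W - \tr (X *m ((\tr W)%:M - W)) - (\tr W) ^+ 2 + 2%:R * \det W).
      by rewrite !mx2E /=; ring.
    by rewrite tXW dW tX; ring.
  have [e e0 ne] := det0_vec dn; exists e => //; split.
    by apply/eqP; rewrite -subr_eq0 -mulmxBl ne.
  exact: (nilp_kernel_eigen n0 tn tWn ne e0).
pose fib e := [set x in (A ^+ n)%g | rho x *m e == rho w *m e].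
have fibP e x : x \in Y -> rho x *m e = rho w *m e -> x \in fib e.
  by rewrite !inE => /andP[-> _] ->; rewrite eqxx.
have fib_par e f x : e != 0 -> f != 0 -> x \in Y -> rho x *m f = rho w *m f ->
    om e f = 0 -> x \in fib e.
  move=> e0 f0 xY xf oef; apply: fibP => //.
  have ofe : om f e = 0 by rewrite omC oef oppr0.
  have [l El] := om_eq0 f0 ofe.
  by rewrite El !linearZ /= xf.
have [Ysub|] := boolP (Y \subset [set w]).
  by apply: leq_trans (subset_leq_card Ysub) _; rewrite cards1.
move=> /subsetPn[x1 x1Y]; rewrite inE => x1w.
have [e1 e10 [x1e1 we1]] := eig _ x1Y x1w.
have [Ysub|] := boolP (Y \subset w |: fib e1).
  apply: leq_trans (subset_leq_card Ysub) _; rewrite cardsU1.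
  apply: leq_trans (leq_add (leq_b1 _) (vector_fiber _ n8 e10)) _.
  by rewrite add1n ltnS mul2n -addnn leq_addr.
move=> /subsetPn[x2 x2Y]; rewrite in_setU1 negb_or => /andP[x2w x2f].
have [e2 e20 [x2e2 we2]] := eig _ x2Y x2w.
have o12 : om e1 e2 != 0 by apply: contraNneq x2f; apply: fib_par x2e2.
have Ysub : Y \subset w |: (fib e1 :|: fib e2).
  apply/subsetP => x xY; rewrite in_setU1; have [//|xw] := eqVneq x w; rewrite in_setU /=.
  have [e3 e30 [xe3 we3]] := eig _ xY xw.
  have [o13|o13] := eqVneq (om e1 e3) 0; first by rewrite (fib_par e1 e3).
  have [o23|o23] := eqVneq (om e2 e3) 0; first by rewrite orbC (fib_par e2 e3).
  by case/negP: (regular_nonscalar wr); apply: three_eigenlines we1 we2 we3 o12 o13 o23.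
apply: leq_trans (subset_leq_card Ysub) _; rewrite cardsU1.
apply: leq_trans (leq_add (leq_b1 _) (leq_trans (leq_card_setU _ _)
  (leq_add (vector_fiber _ n8 e10) (vector_fiber _ n8 e20)))) _.
by rewrite add1n addnn mul2n.
Qed.

(** For equal traces the Fricke polynomial factors as [(tr (x y) - 2) (tr (x y^-1) - 2)]. *)
Lemma det_comm_neq0 x y : tr x = tr y ->
  tr (x * y)%g != 2%:R -> tr (x * y^-1)%g != 2%:R ->
  \det (rho x *m rho y - rho y *m rho x) != 0.
Proof.
move=> txy t1 t2; rewrite det_comm !rho_det.
have tyV : tr (x * y^-1)%g = tr x ^+ 2 - tr (x * y)%g.
  rewrite /tr !rhoM rhoV_tr mulmxBr linearB /= mul_mx_scalar linearZ /=.
  by rewrite -/(tr x) -txy expr2.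
have -> : \tr (rho x *m rho y) = tr (x * y)%g by rewrite /tr rhoM.
rewrite -/(tr x) -/(tr y) -txy.
have -> : 4%:R * 1 * 1 + tr x * tr x * tr (x * y)%g - tr x ^+ 2 * 1 - tr x ^+ 2 * 1 - tr (x * y)%g ^+ 2
   = (tr (x * y)%g - 2%:R) * (tr (x * y^-1)%g - 2%:R) by rewrite tyV; ring.
by rewrite mulf_neq0 // subr_eq0.
Qed.

(** * Elements of [A^4] in one regular semisimple class *)

Section ClassBound.
Variable t : 'F_p.
Hypotheses (t0 : t != 0) (t2 : t != 2%:R) (t2' : t != - 2%:R).
Let X := [set x in (A ^+ 4)%g | tr x == t].

Let Xt x : x \in X -> tr x = t.
Proof. by rewrite inE => /andP[_ /eqP]. Qed.
Let XA x : x \in X -> x \in (A ^+ 4)%g.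
Proof. by rewrite inE => /andP[]. Qed.
Let Xr x : x \in X -> regular x.
Proof. by move=> /Xt E; rewrite /regular E t0 t2 t2'. Qed.

(** The trace conditions make the matrix commutator of [x1] and [x2] invertible; the other two
    exclude both outcomes of [third_factor]. *)
Definition good_triple (u : G * G * G) :=
  let: (x1, x2, x3) := u in
  [&& tr (x1 * x2)%g != 2%:R, tr (x1 * x2^-1)%g != 2%:R, (x2 * x3 != 1)%g & (x2 * x3 != x1 * x2)%g].

Let T := [set u in setX (setX X X) X | good_triple u].

Let few_bad x1 : x1 \in X ->
  (#|[set x2 in X | (tr (x1 * x2)%g == 2%:R) || (tr (x1 * x2^-1)%g == 2%:R)]| <= 2 * (2 * b).+1)%N.
Proof.
move=> x1X; have x1Vr : regular x1^-1%g by rewrite /regular trV; exact: Xr.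
have H1 := unipotent_fiber (isT : 4 <= 8)%N (Xr x1X).
have H2 := unipotent_fiber (isT : 4 <= 8)%N x1Vr.
rewrite mul2n -addnn; apply: leq_trans (leq_add H1 H2).
apply: leq_trans (leq_card_setU _ _); apply: subset_leq_card.
apply/subsetP => x2 /setIdP[x2X tb]; apply/setUP.
have E1 : tr x2 == tr x1 by rewrite !Xt.
case/orP: tb => tb; [right|left]; apply/setIdP; split; rewrite ?XA //.
  by rewrite trV E1 invgK tr_mulC tb.
by rewrite E1 -(trV (x2 * x1^-1)%g) invMg invgK tb.
Qed.

Let far x1 x2 := (tr (x1 * x2)%g != 2%:R) && (tr (x1 * x2^-1)%g != 2%:R).
Let fresh x1 x2 x3 := (x2 * x3 != 1)%g && (x2 * x3 != x1 * x2)%g.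

(** Given [x1], at most [2 (2 b + 1)] choices of [x2] are bad, and then at most two of [x3]. When
    [16 b <= |X|], more than a quarter of the triples survive. *)
Lemma card_good : (16 * b <= #|X|)%N -> (0 < b)%N -> (#|X| ^ 3 <= 4 * #|T|)%N.
Proof.
move=> bX b0.
have X3 x1 x2 : (#|X| <= #|[set x3 in X | fresh x1 x2 x3]| + 2)%N.
  rewrite -(cardsID [set x3 in X | fresh x1 x2 x3] X).
  apply: leq_add; first by apply/subset_leq_card/subsetIr.
  apply: (@leq_trans #|[set x2^-1; x2^-1 * (x1 * x2)]%g|); last by rewrite cards2; case: (_ != _).
  apply/subset_leq_card/subsetP => x3; rewrite !inE => /andP[+ xX]; rewrite xX /=.
  rewrite negb_and !negbK => /orP[]/eqP E; apply/orP; [left|right]; apply/eqP.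
    by apply: (mulgI x2); rewrite E mulgV.
  by rewrite -E mulKg.
have X2 x1 : x1 \in X -> (#|X| <= #|[set x2 in X | far x1 x2]|
    + 2 * (2 * b).+1)%N.
  move=> x1X; rewrite -(cardsID [set x2 in X | far x1 x2] X).
  apply: leq_add; first by apply/subset_leq_card/subsetIr.
  apply: leq_trans (few_bad x1X); apply/subset_leq_card/subsetP => x2.
  move=> /setDP[xX nb]; apply/setIdP; split=> //; move: nb; apply: contraR.
  by rewrite negb_or => tb; apply/setIdP.
have -> : #|T| = (\sum_(x1 in X) \sum_(x2 in X | far x1 x2)
    #|[set x3 in X | fresh x1 x2 x3]|)%N.
  rewrite -sum1_card.
  rewrite (eq_bigr (fun x1 => \sum_(x2 in X | far x1 x2)
     \sum_(x3 in X | fresh x1 x2 x3) 1)%N); last first.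
    by move=> x1 _; apply: eq_bigr => x2 _; rewrite -sum1dep_card.
  rewrite pair_big_dep pair_big_dep /=; apply: eq_bigl => -[[x1 x2] x3].
  by rewrite [LHS]inE !in_setX /=; case: (x1 \in X); case: (x2 \in X); case: (x3 \in X);
    rewrite ?andbF ?andbT //= -!andbA.
apply: (@leq_trans (4 * \sum_(x1 in X) ((#|X| - 2 * (2 * b).+1) * (#|X| - 2)))).
  rewrite sum_nat_const; set n := #|X| in bX *; nia.
rewrite leq_mul2l /=; apply: leq_sum => x1 x1X.
rewrite (eq_bigl (mem [set x2 in X | far x1 x2])); last first.
  by move=> x2 /=; rewrite [RHS]inE.
apply: (@leq_trans (\sum_(x2 in [set x2 in X | far x1 x2]) (#|X| - 2))).
  by rewrite sum_nat_const leq_mul // leq_subLR addnC X2.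
by apply: leq_sum => x2 _; rewrite leq_subLR addnC X3.
Qed.

(** The commutator of [u] and [y] is [x2^-1 (x2 x1 - x1 x2)], invertible by the trace conditions. If
    [u] and [v] commuted, [third_factor] would give [v = 1] or [v = u]. *)
Let good_commutators x1 x2 x3 : (x1, x2, x3) \in T ->
  let u := rho (x1 * x2)%g in let y := rho x2^-1%g in let v := rho (x2 * x3)%g in
  u *m v - v *m u != 0 /\ \det (u *m y - y *m u) != 0.
Proof.
rewrite inE !in_setX /= => /andP[/andP[/andP[x1X x2X] x3X] /and4P[z1 z2 n1 n2]].
have d12 := @det_comm_neq0 x1 x2 (etrans (Xt x1X) (esym (Xt x2X))) z1 z2.
have duy : \det (rho (x1 * x2)%g *m rho x2^-1%g - rho x2^-1%g *m rho (x1 * x2)%g) != 0.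
  have -> : rho (x1 * x2)%g *m rho x2^-1%g - rho x2^-1%g *m rho (x1 * x2)%g =
      rho x2^-1%g *m (rho x2 *m rho x1 - rho x1 *m rho x2).
    rewrite mulmxBr -!rhoM mulgK mulKg; congr (_ - _).
  by rewrite det_mulmx rho_det mul1r -opprB -scaleN1r detZ sqrrN expr1n mul1r.
split=> //; rewrite subr_eq0; apply/eqP => uv.
have us : ~~ is_scalar_mx (rho (x1 * x2)%g).
  apply: contraNN duy => /is_scalar_mxP[c ->].
  by rewrite mul_mx_scalar mul_scalar_mx subrr det0.
have tE x : x \in X -> \tr (rho x) = t by exact: Xt.
have := @third_factor _ (rho x1) (rho x2) (rho x3) (rho_det _) (rho_det _) (rho_det _).
rewrite -!rhoM (tE _ x1X) (tE _ x2X) (tE _ x3X) -/(tr (x1 * x2)%g).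
rewrite -!rhoM in uv => /(_ erefl erefl t0 z1 us (esym uv))[].
  by rewrite -(rho1 G) => /rho_inj E; rewrite E eqxx in n1.
by move/rho_inj => E; rewrite E eqxx in n2.
Qed.

(* For [y = x2^-1] the traces of [y], [u y] and [v y] all equal [t]. *)
Let triple_fiber (uv : G * G) :
  (#|[set s in T | ((s.1.1 * s.1.2)%g, (s.1.2 * s.2)%g) == uv]| <= 2)%N.
Proof.
case: uv => u v; set Y := [set _ in _ | _].
have YE x1 x2 x3 : (x1, x2, x3) \in Y ->
    [/\ (x1, x2, x3) \in T, x1 = (u * x2^-1)%g & x3 = (x2^-1 * v)%g].
  by move=> /setIdP[sT /eqP[<- <-]]; rewrite mulgK mulKg.
have traces x1 x2 x3 : (x1, x2, x3) \in Y -> [/\ tr x2^-1%g = t,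
    \tr (rho u *m rho x2^-1%g) = t & \tr (rho v *m rho x2^-1%g) = t].
  move=> /YE[]; rewrite inE !in_setX /= => /andP[/andP[/andP[x1X x2X] x3X] _] E1 E3.
  rewrite -!rhoM -E1 -/(tr x1) -/(tr (v * x2^-1)%g) tr_mulC -E3 trV.
  by rewrite !Xt.
apply: (@card_le2 _ _ (fun s : G * G * G => rho s.1.2^-1%g)) => [|[[x1 x2] x3] sY].
  move=> [[x1 x2] x3] [[x1' x2'] x3'] /= /YE[_ -> ->] /YE[_ -> ->] /rho_inj/invg_inj ->.
  by [].
have [sT E1 E3] := YE _ _ _ sY; have [tr1 tr2 tr3] := traces _ _ _ sY.
have [] := good_commutators sT; rewrite E1 E3 mulgKV mulKVg => n0 duy.
set n := rho u *m rho v - rho v *m rho u in n0.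
exists (rho x2^-1%g + (\tr (rho x2^-1%g *m n) / \det n) *: n) => -[[y1 y2] y3] s'Y /=.
have [tr1' tr2' tr3'] := traces _ _ _ s'Y.
have [dn|dn] := eqVneq (\det n) 0.
  left; apply: (three_traces_one n0 dn duy); first by rewrite !rho_det.
  - by rewrite -/(tr y2^-1%g) tr1'.
  - by rewrite tr2 tr2'.
  - by rewrite tr3 tr3'.
apply: (three_traces_two dn); first by rewrite !rho_det.
- by rewrite -/(tr y2^-1%g) tr1'.
- by rewrite tr2 tr2'.
- by rewrite tr3 tr3'.
Qed.

(** A class with at least [16 b] elements has enough good triples, and these map at most two to one
    into pairs of elements of [A^8]. A smaller class satisfies the bound by
    [b^3 <= b^4 <= (M |A|)^2]. *)
Lemma class_bound : (0 < b)%N -> (#|X| ^ 3 <= 16 ^ 3 * (M * #|A|) ^ 2)%N.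
Proof.
move=> b0; have [bX|Xb] := leqP (16 * b) #|X|.
  apply: leq_trans (card_good bX b0) _.
  have : (#|T| <= #|setX (A ^+ 8)%g (A ^+ 8)%g| * 2)%N.
    apply: (card_le_fibers (f := fun s : G * G * G => ((s.1.1 * s.1.2)%g, (s.1.2 * s.2)%g))).
      move=> [[x1 x2] x3]; rewrite inE !in_setX /= => /andP[/andP[/andP[x1X x2X] x3X] _].
      by rewrite !(mem_powM (m := 4) (n := 4)) ?XA.
    by move=> uv _; exact: triple_fiber.
  have A8 := card_pow_le (isT : 8 <= 17)%N; rewrite cardsX => T8.
  move: A8 T8; set n8 := #|(A ^+ 8)%g|; set N := (M * #|A|)%N => A8 T8.
  have H2 : (n8 * n8 <= N ^ 2)%N by rewrite leq_mul.
  clear -T8 H2; lia.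
have X3 : (#|X| ^ 3 <= 16 ^ 3 * b ^ 3)%N by rewrite -expnMn leq_exp2r // ltnW.
apply: leq_trans X3 _; rewrite leq_pmul2l //.
apply: (@leq_trans ((b ^ 2) ^ 2)); last by rewrite leq_exp2r.
by rewrite -expnM leq_pexp2l.
Qed.
End ClassBound.

Let A_gt0 : (0 < #|A|)%N.
Proof. by apply/card_gt0P; exists 1%g. Qed.

Let M_gt0 : (0 < M)%N. Proof. exact: leq_trans M64. Qed.

Let b_gt0 : (0 < b)%N.
Proof.
rewrite lt0n; apply: contraTneq b_gt => ->; rewrite -leqNgt.
by rewrite muln_gt0 M_gt0.
Qed.

Definition torus_size z := #|(A ^+ 2)%g :&: 'C[z]%g|.

(** Orbit and stabilizer: [a |-> z^(a^-1)] sends [A] into the class of [z] in [A^4], and two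
    elements of one fiber differ by an element of [A^2] centralizing [z]. *)
Lemma torus_large z : z \in (A ^+ 2)%g -> regular z ->
  (#|A| <= M ^ 4 * torus_size z ^ 3)%N.
Proof.
move=> zA zr; set r := torus_size z; have /and3P[t0 t2 t2'] := zr.
set X := [set x in (A ^+ 4)%g | tr x == tr z].
have AXr : (#|A| <= #|X| * r)%N.
  apply: (card_le_fibers (f := fun a => z ^ a^-1)%g) => [a aA|y _].
    apply/setIdP; split; last by rewrite trJ.
    rewrite conjgE invgK; have aA1 := mem_pow1 aA.
    exact: (mem_powM (m := 1) (n := 3) aA1 (mem_powM (m := 2) (n := 1) zA (mem_powV AV aA1))).
  set Y := [set _ in _ | _]; have [->|[a0]] := set_0Vmem Y; first by rewrite cards0.
  move=> /setIdP[a0A /eqP Ea0]; rewrite -(card_imset _ (mulgI a0^-1%g)).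
  apply/subset_leq_card/subsetP => _ /imsetP[a /setIdP[aA /eqP Ea] ->].
  apply/setIP; split.
    exact: (mem_powM (m := 1) (n := 1) (mem_pow1 (mem_invA AV a0A)) (mem_pow1 aA)).
  apply/cent1P; apply: commute_sym; apply/commgP/conjg_fixP.
  by rewrite conjgM Ea0 -Ea -conjgM mulVg conjg1.
have X3 := class_bound t0 t2 t2' b_gt0; rewrite -/X in X3.
have : (#|A| ^ 3 <= M ^ 4 * r ^ 3 * #|A| ^ 2)%N.
  apply: (@leq_trans ((#|X| * r) ^ 3)); first by rewrite leq_exp2r.
  rewrite expnMn; apply: (@leq_trans (16 ^ 3 * (M * #|A|) ^ 2 * r ^ 3)).
    by rewrite leq_mul2r X3 orbT.
  rewrite expnMn; have -> : (M ^ 4 * r ^ 3 * #|A| ^ 2 = M ^ 2 * (M ^ 2 * #|A| ^ 2) * r ^ 3)%N by ring.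
  rewrite leq_mul2r leq_mul2r; apply/orP; right; apply/orP; right.
  by apply: (@leq_trans (64 ^ 2)) => //; rewrite leq_exp2r.
by rewrite [(#|A| ^ 3)%N]expnS leq_pmul2r // expn_gt0 A_gt0.
Qed.

Hypothesis A_big : (M ^ 9 < #|A|)%N.

(** [M^9 < |A| <= M^7 |Y|^3] gives [|Y|^3 > M^2 >= 16^3], so the at most six singular elements are
    fewer than half of [Y]. *)
Lemma regular_in_torus z (Y : {set G}) : regular z -> Y \subset 'C[z]%g ->
  (#|A| <= M ^ 7 * #|Y| ^ 3)%N -> (#|Y| <= 2 * #|[set y in Y | regular y]|)%N /\ (0 < #|Y|)%N.
Proof.
move=> zr YC AY; have Y16 : (16 < #|Y|)%N.
  rewrite -(ltn_exp2r _ _ (isT : 0 < 3)%N); apply: (@leq_ltn_trans (M ^ 2)).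
    by apply: (@leq_trans (64 ^ 2)) => //; rewrite leq_exp2r.
  rewrite -(ltn_pmul2l (m := M ^ 7)) ?expn_gt0 ?M_gt0 // -expnD.
  exact: leq_trans A_big AY.
have := card_singular p_pr p_gt2 zr YC; set n := #|[set _ in _ | _]|.
by move: Y16; clear; lia.
Qed.

(** Conjugation by [a] puts the torus of [z] inside [A^4], and [card_pow_conj] returns to [A^2] at
    the cost of one factor [M]. Cubed, this turns [M^4] into [M^7]. *)
Lemma torus_pivot z a : z \in (A ^+ 2)%g -> regular z -> a \in A ->
  exists z', [/\ z' \in (A ^+ 2)%g, regular z' & z' \in 'C[z ^ a]%g].
Proof.
move=> zA zr aA; have zar : regular (z ^ a)%g by rewrite /regular trJ.
set Y := (A ^+ 2)%g :&: 'C[z ^ a]%g.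
have rY : (torus_size z <= M * #|Y|)%N.
  have := card_pow_conj AV [group of 'C[z ^ a]%g] 4; rewrite /= -/Y => H4.
  have A5 := card_pow_le (isT : 5 <= 17)%N.
  have : (torus_size z <= #|(A ^+ 4)%g :&: 'C[z ^ a]%g|)%N.
    rewrite /torus_size -[leqLHS](card_imset _ (conjg_inj a)).
    apply/subset_leq_card/subsetP => _ /imsetP[x /setIP[xA xC] ->].
    apply/setIP; split; last by rewrite cent1J memJ_conjg.
    have aA1 := mem_pow1 aA; rewrite conjgE.
    exact: (mem_powM (m := 1) (n := 3) (mem_powV AV aA1) (mem_powM (m := 2) (n := 1) xA aA1)).
  rewrite -(leq_pmul2r A_gt0) => H; rewrite -(leq_pmul2r A_gt0).
  apply: leq_trans H (leq_trans H4 _); rewrite mulnAC leq_mul2r; apply/orP; right.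
  exact: A5.
have AY : (#|A| <= M ^ 7 * #|Y| ^ 3)%N.
  apply: leq_trans (torus_large zA zr) _; rewrite -[7%N]/(4 + 3)%N expnD -mulnA.
  by rewrite leq_mul2l -expnMn leq_exp2r ?rY ?orbT.
have [Y2 Y0] := regular_in_torus zar (subsetIr _ _) AY.
have /card_gt0P[z'] : (0 < #|[set y in Y | regular y]|)%N.
  by rewrite lt0n; apply: contraTneq (leq_trans Y0 Y2) => ->; rewrite muln0.
by move=> /setIdP[/setIP[z'A z'C] z'r]; exists z'.
Qed.

(** Induction on the length of [g] as a word in [A]. Each step produces a new regular element of
    [A^2] in the conjugate torus and restarts from it, so the bounds do not degrade with length. *)
Lemma torus_everywhere z g : z \in (A ^+ 2)%g -> regular z ->
  exists z', [/\ z' \in (A ^+ 2)%g, regular z' & z' \in 'C[z ^ g]%g].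
Proof.
move=> zA zr.
have : g \in <<A>>%g by rewrite gen_full inE.
move=> /gen_prodgP[n [c cA ->]]; elim: n c cA => [|n IH] c cA.
  by exists z; rewrite big_ord0 conjg1 zA zr cent1id.
rewrite big_ord_recr /=; set h := (\prod_(i < n) _)%g.
have [|z1 [z1A z1r z1C]] := IH (fun i => c (widen_ord (leqnSn n) i)).
  by move=> i; exact: cA.
have [z2 [z2A z2r z2C]] := torus_pivot z1A z1r (cA ord_max).
exists z2; split=> //; rewrite conjgM cent1J -/h.
have hr : regular (z ^ h)%g by rewrite /regular trJ.
by rewrite -(cent_regular hr z1r z1C) -cent1J.
Qed.

(** Double counting of pairs [(g, x)] with [x] regular in [A^2] and in the torus of [z^g]: about
    [|A|^(1/3)] elements [x] for each [g], at most [4 p] elements [g] for each [x]. *)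
Lemma product_bound z : z \in (A ^+ 2)%g -> regular z ->
  (p ^ 6 <= M ^ 10 * #|A| ^ 2)%N.
Proof.
move=> zA zr; pose reg g := [set y in (A ^+ 2)%g :&: 'C[z ^ g]%g | regular y].
have regP g : (#|A| <= M ^ 5 * #|reg g| ^ 3)%N.
  have [z' [z'A z'r z'C]] := torus_everywhere g zA zr.
  have zgr : regular (z ^ g)%g by rewrite /regular trJ.
  have := torus_large z'A z'r; rewrite /torus_size (cent_regular zgr z'r z'C).
  set Y := _ :&: _ => AY.
  have [|Y2 _] := regular_in_torus zgr (subsetIr _ _ : Y \subset _).
    by apply: leq_trans AY _; rewrite leq_mul2r leq_pexp2l // orbT.
  apply: leq_trans AY _; rewrite [(M ^ 5)%N]expnSr -mulnA leq_mul2l; apply/orP; right.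
  apply: (@leq_trans ((2 * #|reg g|) ^ 3)); first by rewrite leq_exp2r.
  by rewrite expnMn leq_mul2r; apply/orP; right; exact: leq_trans M64.
(* The least such [R] plays the role of [(|A| / M^5)^(1/3)] rounded up; by minimality it is at most
   [#|reg g|] for every [g]. *)
have exR : exists R, (#|A| <= M ^ 5 * R ^ 3)%N by exists #|reg 1%g|; exact: regP.
case: (ex_minnP exR) => R RA Rmin.
have count : (#|G| * R <= M * #|A| * (4 * p))%N.
  apply: (@leq_trans (\sum_(g : G) #|reg g|)).
    by rewrite -[#|G|]/#|xpredT| -sum_nat_const; apply: leq_sum => g _; apply: Rmin.
  have -> : (\sum_(g : G) #|reg g| = \sum_(x in (A ^+ 2)%g | regular x) #|[set g | x \in 'C[z ^ g]%g]|)%N.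
    rewrite (eq_bigr (fun g => \sum_(x in (A ^+ 2)%g | regular x) (x \in 'C[z ^ g]%g))%N).
      rewrite exchange_big; apply: eq_bigr => x _.
      by rewrite -sum1dep_card [RHS]big_mkcond; apply: eq_bigr => g _; case: (_ \in _).
    move=> g _; rewrite -sum1dep_card big_mkcond [RHS]big_mkcond; apply: eq_bigr => x _.
    by rewrite in_setI; case: (x \in (A ^+ 2)%g); case: (regular x); case: (_ \in _).
  apply: (@leq_trans (\sum_(x in (A ^+ 2)%g) 4 * p)); last first.
    by rewrite sum_nat_const leq_mul2r card_pow_le ?orbT.
  rewrite [leqLHS]big_mkcondr /=; apply: leq_sum => x xA; case: ifP => // xr.
  (* Conjugating [x] by [g^-1] lands in the torus of [z] with trace [tr x]: two choices. The [g]
     giving one choice lie in a coset of the centralizer of [x], of size at most [2 p]. *)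
  apply: (@leq_trans (#|[set y in 'C[z]%g | tr y == tr x]| * (2 * p))); last first.
    by rewrite -[4%N]/(2 * 2)%N -mulnA leq_mul2r (card_cent_tr p_pr p_gt2 _ zr) orbT.
  apply: (card_le_fibers (f := fun g => x ^ g^-1)%g) => [g|y _].
    by rewrite inE cent1J mem_conjg => xC; apply/setIdP; rewrite trJ.
  apply: leq_trans (card_cent p_pr p_gt2 xr).
  set Y := [set _ in _ | _]; have [->|[g0]] := set_0Vmem Y; first by rewrite cards0.
  move=> /setIdP[_ /eqP Eg0]; rewrite -(card_imset _ (mulgI g0^-1%g)).
  apply/subset_leq_card/subsetP => _ /imsetP[g /setIdP[_ /eqP Eg] ->].
  apply/cent1P; apply: commute_sym; apply/commgP/conjg_fixP.
  by rewrite conjgM Eg0 -Eg -conjgM mulVg conjg1.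
rewrite (card_sl2 G p_pr) in count.
have p0 := prime_gt0 p_pr.
have {}count : (p ^ 2 * R <= 8 * (M * #|A|))%N.
  have : (p * ((p ^ 2).-1 * R) <= p * (4 * (M * #|A|)))%N.
    by move: count; rewrite [((p ^ 2).-1 * p)%N]mulnC -mulnA => H; apply: leq_trans H _;
      rewrite (mulnC 4 p) mulnCA (mulnC 4).
  rewrite leq_pmul2l // => H.
  have : (p ^ 2 <= 2 * (p ^ 2).-1)%N by move: p_gt2; clear; case: p => [|[|n]] //; lia.
  by move=> H2; apply: leq_trans (leq_mul H2 (leqnn R)) _; move: H; clear; lia.
have : (p ^ 6 * #|A| <= M ^ 10 * #|A| ^ 2 * #|A|)%N.
  apply: (@leq_trans (p ^ 6 * (M ^ 5 * R ^ 3))); first by rewrite leq_mul2l RA orbT.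
  have -> : (p ^ 6 * (M ^ 5 * R ^ 3) = M ^ 5 * (p ^ 2 * R) ^ 3)%N by rewrite expnMn -expnM mulnCA.
  have -> : (M ^ 10 * #|A| ^ 2 * #|A| = M ^ 5 * (M ^ 2 * (M * #|A|) ^ 3))%N by ring.
  rewrite leq_mul2l; apply/orP; right.
  apply: (@leq_trans ((8 * (M * #|A|)) ^ 3)); first by rewrite leq_exp2r.
  rewrite expnMn leq_mul2r; apply/orP; right.
  by apply: (@leq_trans (64 ^ 2)) => //; rewrite leq_exp2r.
by rewrite leq_pmul2r.
Qed.

(** Otherwise traces on [A^2] take only three values. For noncommuting [g], [h] in [A] the traces of
    [y], [g y], [h y] take at most 27 values, each for at most [2 b] elements [y], so [|A| <= 54 b],
    against [M^9 < |A|]. *)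
Lemma exists_regular : exists2 z, z \in (A ^+ 2)%g & regular z.
Proof.
apply/exists_inP; apply: contraT; rewrite negb_exists_in => /forall_inP none.
pose S3 : {set 'F_p} := [set 0; 2%:R; - 2%:R].
have S3P x : x \in (A ^+ 2)%g -> tr x \in S3.
  move=> /none; apply: contraR; rewrite !inE => /norP[/norP[t1 t2] t3].
  by rewrite /regular t1 t2.
have cS3 : (#|S3| <= 3)%N.
  by apply: leq_trans (leq_card_setU _ _) _; rewrite cards2 cards1; case: (_ != _).
have [g [h [gA hA gh]]] := exists_noncommuting.
set n := rho g *m rho h - rho h *m rho g.
have n0 : n != 0 by rewrite subr_eq0; apply/eqP => /mx_commute.
pose f y := ((tr y, tr (g * y)%g), tr (h * y)%g).
have AS : (#|A| <= #|setX (setX S3 S3) S3| * (2 * b))%N.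
  apply: (card_le_fibers (f := f)) => [y yA|v _].
    have A2 x : x \in A -> (x * y)%g \in (A ^+ 2)%g.
      by move=> xA; exact: (mem_powM (m := 1) (n := 1) (mem_pow1 xA) (mem_pow1 yA)).
    have y2 : y \in (A ^+ 2)%g by rewrite -[y]mul1g A2.
    apply/setXP; split; [apply/setXP; split|]; apply: S3P => //; exact: A2.
  set Y := [set _ in _ | _].
  have YE y y' : y \in Y -> y' \in Y -> [/\ \tr (rho y') = \tr (rho y),
      \tr (rho g *m rho y') = \tr (rho g *m rho y) & \tr (rho h *m rho y') = \tr (rho h *m rho y)].
    move=> /setIdP[_ /eqP Ey] /setIdP[_ /eqP Ey'].
    have [t1 t2 t3] : f y' = f y by rewrite Ey Ey'.
    by rewrite -!rhoM.
  have [dn|dn] := eqVneq (\det n) 0; last first.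
    apply: (@leq_trans 2); last by rewrite leq_pmulr.
    apply: (@card_le2 _ _ (@rho _ G)) => [x y _ _|y yY]; first exact: rho_inj.
    exists (rho y + (\tr (rho y *m n) / \det n) *: n) => y' y'Y.
    have [t1 t2 t3] := YE _ _ yY y'Y.
    by apply: (three_traces_two dn) => //; rewrite !rho_det.
  have [e e0 He] := three_traces_vec n0 dn.
  have [->|[y yY]] := set_0Vmem Y; first by rewrite cards0.
  apply: (@leq_trans b); last by rewrite leq_pmull.
  apply: leq_trans (vector_fiber (rho y *m e) (isT : 1 <= 8)%N e0).
  apply/subset_leq_card/subsetP => y' y'Y; have [t1 t2 t3] := YE _ _ yY y'Y.
  apply/setIdP; split; last by apply/eqP; exact: He.
  by apply: mem_pow1; case/setIdP: y'Y.
have Ab : (#|A| <= 54 * b)%N.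
  apply: leq_trans AS _; rewrite !cardsX mulnA leq_mul2r; apply/orP; right.
  by rewrite (_ : 54 = 3 * 3 * 3 * 2)%N // leq_mul2r /= !leq_mul.
have AM : (#|A| * #|A| <= 54 ^ 2 * M * #|A|)%N.
  apply: (@leq_trans ((54 * b) ^ 2)); first by rewrite -[leqLHS]/(#|A| ^ 2)%N leq_exp2r.
  by rewrite expnMn -mulnA leq_mul2l b_le orbT.
rewrite leq_pmul2r // in AM.
have := leq_trans A_big AM; rewrite ltnNge => /negP[].
apply: (@leq_trans (M ^ 2 * M)).
  by rewrite leq_mul2r leq_exp2r // (leq_trans _ M64) // orbT.
by rewrite -expnSr leq_pexp2l.
Qed.
End ProductTheorem.

Theorem product_theorem (p : nat) (G : sl2_model p) (A : {set G}) (M : nat) :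
  prime p -> (2 < p)%N -> (1 \in A)%g -> (A^-1)%g = A ->
  (forall H : {group G}, H \proper [set: G] -> ~ A \subset H) ->
  (64 <= M)%N -> (#|(A ^+ 17)%g| <= M * #|A|)%N -> (M ^ 9 < #|A|)%N ->
  (p ^ 6 <= M ^ 10 * #|A| ^ 2)%N.
Proof.
move=> p_pr p2 A1 AV Agen M64 A17 Abig.
have [b /andP[b1 b2]] := nat_sqrt (M * #|A|).
have [z zA zr] := exists_regular A1 AV Agen M64 A17 b1 b2 Abig.
exact: (product_bound p_pr p2 A1 AV Agen M64 A17 b1 b2 Abig zA zr).
Qed.

(** * Small quotient sets *)

Section FiniteSums.
Local Open Scope nat_scope.

Lemma sum_sqr_leq (I : finType) (X : {set I}) (a : I -> nat) :
  (\sum_(i in X) a i) ^ 2 <= #|X| * \sum_(i in X) a i ^ 2.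
Proof.
rewrite -(leq_pmul2l (isT : 0 < 2)).
have -> : 2 * (\sum_(i in X) a i) ^ 2 = \sum_(i in X) \sum_(j in X) 2 * (a i * a j).
  rewrite -mulnn big_distrl big_distrr /=; apply: eq_bigr => i _.
  by rewrite big_distrr big_distrr.
have -> : 2 * (#|X| * \sum_(i in X) a i ^ 2) = \sum_(i in X) \sum_(j in X) (a i ^ 2 + a j ^ 2).
  rewrite [RHS](eq_bigr (fun i => #|X| * a i ^ 2 + \sum_(j in X) a j ^ 2)); last first.
    by move=> i _; rewrite big_split sum_nat_const.
  by rewrite big_split /= sum_nat_const -big_distrr /= addnn mul2n.
by apply: leq_sum => i _; apply: leq_sum => j _; rewrite nat_Cauchy.
Qed.

Lemma sum_nat_bool (I : finType) (X : {set I}) (P : pred I) :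
  \sum_(i in X) P i = #|[set i in X | P i]|.
Proof. by rewrite -sum1dep_card [RHS]big_mkcondr; apply: eq_bigr => i _; case: (P i). Qed.

End FiniteSums.

Section PopularQuotients.
Local Open Scope nat_scope.
Variables (gT : finGroupType) (B : {set gT}) (L : nat).
Local Notation C := ((B^-1)%g * B)%g.
Hypotheses (B_gt0 : 0 < #|B|) (L_gt0 : 0 < L) (smallC : #|C| <= L * #|B|).

Definition quotient_reps g := #|[set b in B | (g * b)%g \in B]|.
(** The threshold [|B| / (2 L)] is half the lower bound [|B| / L] for the average of [r] over pairs
    of [B], which follows from Cauchy-Schwarz. *)
Definition popular_quotients := [set g | #|B| <= 2 * L * quotient_reps g].
Local Notation r := quotient_reps.
Local Notation D := popular_quotients.

Lemma popular_quotients1 : (1 \in D)%g.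
Proof.
rewrite inE /r (_ : [set b in B | _] = B); first by rewrite leq_pmull ?muln_gt0.
by apply/setP => b; rewrite inE mul1g andbb.
Qed.

Lemma popular_quotientsV : (D^-1)%g = D.
Proof.
have rV g : r g^-1 <= r g.
  rewrite /r -(card_imset _ (mulgI g^-1%g)); apply/subset_leq_card/subsetP.
  by move=> _ /imsetP[x /setIdP[xB gxB] ->]; apply/setIdP; rewrite mulKVg.
apply/setP => g; rewrite inE !inE; suff -> : r g^-1 = r g by [].
by apply/eqP; rewrite eqn_leq rV -{1}(invgK g) rV.
Qed.

(** Summing [r] over all quotients [b a^-1] gives the energy of [B], also computed through [B^-1 B],
    hence at least [|B|^3 / L]. Unpopular quotients carry at most half of it, so some row has many
    popular ones. *)
Lemma popular_quotients_translate :
  exists2 b, b \in B & #|B| <= 2 * L * #|[set a in B | (a * b^-1)%g \in D]|.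
Proof.
pose s c := #|[set a in B | (a * c)%g \in B]|.
have fibC c : \sum_(t in setX B B | (t.1^-1 * t.2 == c)%g) 1 = s c.
  have inj : injective (fun a => (a, (a * c)%g)) by move=> a a' [].
  rewrite sum1dep_card /s -[RHS](card_imset _ inj); apply: eq_card => -[a b].
  apply/setIdP/imsetP => [[/setXP[/= aB bB] /eqP <-]|[x /setIdP[xB xcB] [-> ->]]].
    by exists a; rewrite ?mulKVg // inE aB mulKVg.
  by rewrite in_setX xB xcB mulKg.
have tC (t : gT * gT) : t \in setX B B -> (t.1^-1 * t.2)%g \in C.
  by case: t => a b /setXP[aB bB]; rewrite mem_mulg // inE invgK.
have sumC : \sum_(c in C) s c = #|B| ^ 2.
  rewrite -[RHS]cardsX -[RHS]sum1_card (partition_big (fun t => t.1^-1 * t.2)%g (mem C)) //=.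
  by apply: eq_bigr => c _; rewrite fibC.
have sumE : \sum_(a in B) \sum_(b in B) r (b * a^-1)%g = \sum_(c in C) s c ^ 2.
  have -> : \sum_(a in B) \sum_(b in B) r (b * a^-1)%g =
      \sum_(t in setX B B) s (t.1^-1 * t.2)%g.
    rewrite [RHS](eq_bigl (fun t => (t.1 \in B) && (t.2 \in B))); last by move=> t; rewrite inE.
    rewrite -(pair_big (mem B) (mem B) (fun a b => s (a^-1 * b)%g)) /=.
    apply: eq_bigr => a aB; rewrite (eq_bigr (fun b => \sum_(d in B) ((b * (a^-1 * d))%g \in B))).
      by rewrite exchange_big; apply: eq_bigr => d _; rewrite sum_nat_bool.
    by move=> b _; rewrite sum_nat_bool /r; under eq_finset do rewrite -mulgA.
  rewrite (partition_big (fun t => t.1^-1 * t.2)%g (mem C)) //=.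
  apply: eq_bigr => c _; rewrite (eq_bigr (fun=> s c * 1)); last by move=> t /andP[_ /eqP->]; rewrite muln1.
  by rewrite -big_distrr /= fibC.
have energy : #|B| ^ 3 <= L * \sum_(a in B) \sum_(b in B) r (b * a^-1)%g.
  rewrite sumE -(leq_pmul2l B_gt0) -expnS -[4]/(2 * 2) expnM -sumC.
  apply: leq_trans (sum_sqr_leq _ _) _; rewrite mulnA [#|B| * L]mulnC.
  by rewrite leq_mul2r smallC orbT.
have rB g : r g <= #|B| by apply/subset_leq_card/subsetP => b /setIdP[].
have split_sum : 2 * L * \sum_(a in B) \sum_(b in B) r (b * a^-1)%g <=
    2 * L * #|B| * (\sum_(a in B) #|[set b in B | (b * a^-1)%g \in D]|) + #|B| ^ 3.
  have -> : #|B| ^ 3 = \sum_(a in B) \sum_(b in B) #|B| by rewrite !sum_nat_const.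
  rewrite !big_distrr /= -big_split /=; apply: leq_sum => a aB.
  rewrite -sum_nat_bool !big_distrr /= -big_split /=; apply: leq_sum => b bB.
  case: (boolP (_ \in D)) => [_|].
    by rewrite muln1 (leq_trans (_ : _ <= 2 * L * #|B|)) ?leq_addr // leq_mul2l rB orbT.
  by rewrite inE -ltnNge muln0 => /ltnW.
apply/exists_inP; apply: contraT; rewrite negb_exists_in => /forall_inP none.
have : 2 * L * (\sum_(a in B) #|[set b in B | (b * a^-1)%g \in D]|) < #|B| ^ 2.
  rewrite big_distrr /= -[_ ^ 2]/(#|B| * #|B|) -sum_nat_const.
  have /card_gt0P[b0 b0B] := B_gt0.
  rewrite (bigD1 b0) //= [ltnRHS](bigD1 b0) //= -addSn leq_add //; first by rewrite ltnNge none.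
  by apply: leq_sum => b /andP[bB _]; rewrite ltnW // ltnNge none.
rewrite -(ltn_pmul2l B_gt0) -expnS => H.
have : 2 * L * \sum_(a in B) \sum_(b in B) r (b * a^-1)%g < 2 * #|B| ^ 3.
  apply: leq_ltn_trans split_sum _; rewrite [ltnRHS]mul2n -addnn ltn_add2r.
  by apply: leq_ltn_trans H; rewrite mulnA [#|B| * _]mulnC.
by rewrite -mulnA ltn_pmul2l // ltnNge energy.
Qed.

(* [conv n] is the convolution of [1_B] with [n] copies of [1_C]. *)
Fixpoint conv n (y : gT) : nat :=
  if n is n'.+1 then \sum_(c in C) conv n' (y * c^-1)%g else (y \in B).

Lemma sum_conv n : \sum_y conv n y = #|B| * #|C| ^ n.
Proof.
elim: n => [|n IH] /=.
  by rewrite muln1 -sum1_card [RHS]big_mkcond; apply: eq_bigr => y _; case: (y \in B).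
rewrite exchange_big /= (eq_bigr (fun=> #|B| * #|C| ^ n)) => [|c _].
  by rewrite sum_nat_const expnS mulnCA.
by rewrite -IH [RHS](reindex_inj (mulIg c^-1%g)).
Qed.

(** Write each popular factor as [b' b^-1] in at least [|B| / (2 L)] ways: the product telescopes,
    since [x' (g b) = (x' b') (b'^-1 g b)] with the last factor in [C]. *)
Lemma conv_popular n x : x \in (D ^+ n.+1)%g ->
  #|B| ^ n.+1 <= (2 * L) ^ n.+1 * \sum_(b in B) conv n (x * b)%g.
Proof.
elim: n x => [|n IH] x.
  by rewrite expg1 !expn1 inE /r -sum_nat_bool.
rewrite expgSr => /mulsgP[x' g x'D gD ->].
rewrite expnS [(2 * L) ^ _]expnS -mulnA.
have Hg : #|B| <= 2 * L * r g by rewrite inE in gD.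
have step : r g * \sum_(b in B) conv n (x' * b)%g <= \sum_(b in B) conv n.+1 (x' * g * b)%g.
  rewrite /r -sum_nat_const [leqRHS](bigID (fun b => (g * b)%g \in B)) /=.
  apply: leq_trans (leq_addr _ _); rewrite (eq_bigl (fun b => (b \in B) && ((g * b)%g \in B))).
    apply: leq_sum => b /andP[bB gbB].
    pose h b' := (b'^-1 * (g * b))%g.
    have hinj : injective h by move=> u v /mulIg/invg_inj.
    have hC : h @: B \subset C.
      by apply/subsetP => _ /imsetP[b' b'B ->]; rewrite mem_mulg // inE invgK.
    rewrite [leqRHS](big_setID (h @: B)) /= (setIidPr hC); apply: leq_trans (leq_addr _ _).
    rewrite [leqRHS]big_imset /=; last by move=> u v _ _; exact: hinj.
    by apply: leq_sum => b' _; rewrite /h invMg invgK (mulgA _ (g * b)^-1 b')%g -(mulgA x' g b) mulgK.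
  by move=> b; rewrite inE.
apply: (@leq_trans ((2 * L * r g) * ((2 * L) ^ n.+1 * \sum_(b in B) conv n (x' * b)%g))).
  by rewrite leq_mul ?IH.
have -> : 2 * L * r g * ((2 * L) ^ n.+1 * \sum_(b in B) conv n (x' * b)%g) =
   2 * L * ((2 * L) ^ n.+1 * (r g * \sum_(b in B) conv n (x' * b)%g)) by ring.
by rewrite !leq_mul2l step !orbT.
Qed.

(** The representations supplied by [conv_popular] are weighed against their total number, [|B|]
    times [|B| |C|^n]. *)
Lemma card_popular_pow n : #|(D ^+ n.+1)%g| <= (2 * L) ^ n.+1 * L ^ n * #|B|.
Proof.
have B1 : 0 < #|B| ^ n.+1 by rewrite expn_gt0 B_gt0.
rewrite -(leq_pmul2r B1) -sum_nat_const.
apply: (@leq_trans (\sum_(x in (D ^+ n.+1)%g) (2 * L) ^ n.+1 * \sum_(b in B) conv n (x * b)%g)).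
  by apply: leq_sum => x xD; exact: conv_popular.
rewrite -big_distrr /= -!mulnA leq_mul2l; apply/orP; right.
apply: (@leq_trans (\sum_(x : gT) \sum_(b in B) conv n (x * b)%g)).
  by rewrite [leqRHS](bigID (mem (D ^+ n.+1)%g)) /= leq_addr.
rewrite exchange_big /= (eq_bigr (fun=> #|B| * #|C| ^ n)) => [|b _]; last first.
  by rewrite -sum_conv [RHS](reindex_inj (mulIg b)).
rewrite sum_nat_const.
apply: (@leq_trans (#|B| * (#|B| * (L * #|B|) ^ n))).
  rewrite !leq_mul2l; case: (n) => [|m]; first by rewrite !expn0 leqnn !orbT.
  by rewrite leq_exp2r // smallC !orbT.
by rewrite expnMn expnS; apply/eq_leq; ring.
Qed.
End PopularQuotients.

(** * Images of small size *)

Section Critical.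
Local Open Scope nat_scope.
Variables (p : nat) (G : sl2_model p).
Hypothesis p_pr : prime p.
Local Notation V := 'cV['F_p]_2.
Implicit Types (g h s : G).

Definition image_of (S : {set G}) (E : {set V}) : {set V} :=
  [set rho g *m x | g in S, x in E].

Variables (E : {set V}) (S : {set G}) (k N : nat).
Hypotheses (E0 : (0%R : V) \notin E) (En0 : E != set0) (Sn0 : S != set0).
Hypothesis Ek : lines_meet_at_most E k.
Local Notation F := (image_of S E).

Lemma image_ofP x : reflect (exists2 s, s \in S & rho s^-1%g *m x \in E) (x \in F).
Proof.
apply: (iffP imset2P) => [[s e sS eE ->]|[s sS xE]].
  by exists s; rewrite // mulVact.
by exists s (rho s^-1%g *m x); rewrite // -{1}(invgK s) mulVact.
Qed.

Lemma image_of0 : (0%R : V) \notin F.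
Proof. by apply/image_ofP => -[s _]; rewrite mulmx0; apply/negP. Qed.

(** Chebyshev with [F = S(E)], for which each [s] in [S] sends all of [E] into [F]. *)
Lemma image_bound : (2 * #|F| <= p ^ 2) -> #|S| * #|E| <= 12 * (p * k * #|F|).
Proof.
move=> Fp; have E1 : 0 < #|E| by rewrite card_gt0.
have := @popular_bound p G p_pr E F k E0 image_of0 Ek S #|E| 1 isT.
move=> H; have {}H : #|S| * #|E| ^ 2 <= 12 * (p * k * (#|E| * #|F|)).
  rewrite (_ : 12 = 12 * 1 ^ 2) //; apply: H.
    move=> g gS; rewrite mul1n; apply/subset_leq_card/subsetP => e eE; rewrite inE eE /=.
    by apply/image_ofP; exists g; rewrite // mulVact.
  by rewrite muln1 mulnCA leq_mul2l Fp orbT.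
rewrite -(leq_pmul2l E1); apply: leq_trans (leq_trans H _); apply/eq_leq; ring.
Qed.

Hypotheses (N32 : 32 <= N) (FN : #|F| <= N * #|E|) (kN : p * k <= N * #|S|)
  (Fp : 64 * #|F| <= p ^ 2).

Let E_gt0 : 0 < #|E|. Proof. by rewrite card_gt0. Qed.
Let S_gt0 : 0 < #|S|. Proof. by rewrite card_gt0. Qed.
Let F_gt0 : 0 < #|F|.
Proof.
have [/card_gt0P[e eE] /card_gt0P[s sS]] := (E_gt0, S_gt0).
by apply/card_gt0P; exists (rho s *m e); apply/imset2P; exists s e.
Qed.

(** Since [64 |F| <= p^2], the threshold [|E|^2 / (32 |F|)] is at least twice the mean
    [|E|^2 / p^2]. *)
Let Q := [set g : G | #|E| ^ 2 <= 32 * #|F| * hits E E g].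

(** Of the six factors [N], one absorbs 12, four come from [32 |F| <= N^2 |E|] squared, and one from
    [p k <= N |S|]. *)
Let Q_small : #|Q| <= N ^ 6 * #|S|.
Proof.
have b0 : 0 < 32 * #|F| by rewrite muln_gt0.
have := @popular_bound p G p_pr E E k E0 E0 Ek Q (#|E| ^ 2) (32 * #|F|) b0.
move=> H; have {}H : #|Q| * (#|E| ^ 2) ^ 2 <= 12 * (32 * #|F|) ^ 2 * (p * k * (#|E| * #|E|)).
  apply: H => [g|]; first by rewrite inE.
  have -> : 2 * (32 * #|F|) * (#|E| * #|E|) = #|E| ^ 2 * (64 * #|F|) by ring.
  by rewrite leq_mul2l Fp orbT.
have E4 : 0 < (#|E| ^ 2) ^ 2 by rewrite !expn_gt0 E_gt0.
rewrite -(leq_pmul2r E4); apply: leq_trans H _.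
have -> : N ^ 6 * #|S| * (#|E| ^ 2) ^ 2 = N * (N * (N * #|E|)) ^ 2 * (N * #|S| * (#|E| * #|E|)) by ring.
have N12 : 12 <= N by exact: leq_trans N32.
apply: leq_mul; last by rewrite leq_mul2r kN orbT.
by apply: leq_mul => //; rewrite leq_exp2r //; apply: leq_mul.
Qed.

Let fiber x := [set s in S | rho s^-1%g *m x \in E].
Let bad s s' := ((s^-1 * s')%g \notin Q).
Let bad_pairs x := [set t in setX (fiber x) (fiber x) | bad t.1 t.2].

Let sum_fiber : \sum_(x in F) #|fiber x| = #|S| * #|E|.
Proof.
under eq_bigr do rewrite -sum_nat_bool.
rewrite exchange_big /= -sum_nat_const; apply: eq_bigr => s sS.
rewrite sum_nat_bool -(card_imset _ (@act_inj p G s^-1%g)).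
apply: eq_card => e; apply/imsetP/idP => [[x /setIdP[_ xE] ->] //|eE].
have He : rho s^-1%g *m (rho s *m e) = e by exact: mulVact.
exists (rho s *m e) => //; apply/setIdP; rewrite He; split=> //.
by apply/image_ofP; exists s; rewrite // He.
Qed.

Let sum_bad : 32 * #|F| * (\sum_(x in F) #|bad_pairs x|) <= #|S| ^ 2 * #|E| ^ 2.
Proof.
have -> : \sum_(x in F) #|bad_pairs x| =
    \sum_(t in setX S S | bad t.1 t.2)
      #|[set x in F | (rho t.1^-1%g *m x \in E) && (rho t.2^-1%g *m x \in E)]|.
  rewrite (eq_bigr (fun x => \sum_(t in setX S S | bad t.1 t.2)
     ((rho t.1^-1%g *m x \in E) && (rho t.2^-1%g *m x \in E)))).
    by rewrite exchange_big; apply: eq_bigr => t _; rewrite sum_nat_bool.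
  move=> x _; rewrite -sum1dep_card big_mkcond [RHS]big_mkcond; apply: eq_bigr => -[s s'] _.
  rewrite !in_setX /= !inE; case: (s \in S); case: (s' \in S) => //=; rewrite ?andbF //.
  by case: (bad s s'); rewrite ?andbT ?andbF //; case: (_ && _).
rewrite big_distrr /= -mulnn -cardsX -sum_nat_const.
rewrite big_mkcondr; apply: leq_sum => -[s s'] _ /=; case: ifP => //.
rewrite /bad inE -ltnNge => /ltnW; apply: leq_trans; rewrite leq_mul2l; apply/orP; right.
rewrite /hits -(card_imset _ (@act_inj p G s'^-1%g)).
apply/subset_leq_card/subsetP => _ /imsetP[x /setIdP[_ /andP[xE xE']] ->].
by apply/setIdP; split=> //; rewrite mulmxA -rhoM mulgK.
Qed.

(* Dependent random choice over the points of [F]. *)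
Let good_point : exists2 x, x \in F & 16 * #|bad_pairs x| <= #|fiber x| ^ 2 /\
   #|S| ^ 2 * #|E| ^ 2 <= 2 * #|F| ^ 2 * #|fiber x| ^ 2.
Proof.
have [x xF Hx] : exists2 x, x \in F &
    2 * #|F| ^ 2 * (16 * #|bad_pairs x|) + #|S| ^ 2 * #|E| ^ 2 <= 2 * #|F| ^ 2 * #|fiber x| ^ 2.
  apply/exists_inP; apply: contraT; rewrite negb_exists_in => /forall_inP none.
  have : \sum_(x in F) (2 * #|F| ^ 2 * #|fiber x| ^ 2) <
      \sum_(x in F) (2 * #|F| ^ 2 * (16 * #|bad_pairs x|) + #|S| ^ 2 * #|E| ^ 2).
    have /card_gt0P[x0 x0F] := F_gt0.
    rewrite (bigD1 x0) //= [ltnRHS](bigD1 x0) //= -addSn leq_add //; first by rewrite ltnNge none.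
    by apply: leq_sum => x /andP[xF _]; rewrite ltnW // ltnNge none.
  rewrite big_split /= sum_nat_const -!big_distrr /= ltnNge => /negP[].
  apply: (@leq_trans (2 * #|F| * (#|S| ^ 2 * #|E| ^ 2))).
    rewrite (_ : 2 * #|F| * _ = #|F| * (#|S| ^ 2 * #|E| ^ 2) + #|F| * (#|S| ^ 2 * #|E| ^ 2)); last by ring.
    rewrite leq_add2r; apply: leq_trans (leq_mul (leqnn #|F|) sum_bad); apply/eq_leq; ring.
  rewrite -expnMn -sum_fiber; have := sum_sqr_leq F (fun x => #|fiber x|) => H.
  apply: leq_trans (leq_mul (leqnn (2 * #|F|)) H) _; apply/eq_leq; ring.
exists x => //; split.
  rewrite -(leq_pmul2l (m := 2 * #|F| ^ 2)) ?muln_gt0 ?expn_gt0 ?F_gt0 //.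
  by apply: leq_trans Hx; rewrite leq_addr.
by apply: leq_trans Hx; rewrite leq_addl.
Qed.

Let bad_sym s s' : bad s s' = bad s' s.
Proof.
rewrite /bad !inE; congr (~~ (_ <= _ * _)).
have le g : hits E E g <= hits E E g^-1%g.
  rewrite /hits -(card_imset _ (@act_inj p G g)).
  apply/subset_leq_card/subsetP => _ /imsetP[e /setIdP[eE geE] ->].
  by apply/setIdP; rewrite mulVact.
have EV : ((s^-1 * s')^-1 = s'^-1 * s)%g by rewrite invMg invgK.
by apply/eqP; rewrite eqn_leq -EV le -{2}(invgK (s^-1 * s')%g) le.
Qed.

(** [B] consists of the elements of a good fiber [A] that are in few bad pairs. For [s], [s'] in
    [B], at least half of the [c] in [A] are good with both, so [s^-1 s' = (s^-1 c) (c^-1 s')] has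
    many factorizations in [Q Q], while there are only [|Q|^2] products. *)
Lemma dense_small_quotient : exists2 B : {set G}, B \subset S &
  [/\ 0 < #|B|, #|S| <= N ^ 3 * #|B| & #|((B^-1)%g * B)%g| <= N ^ 16 * #|B|].
Proof.
have [x xF [bad16 dense]] := good_point.
set A := fiber x in bad16 dense; set a := #|A| in bad16 dense.
have Sa : #|S| <= 2 * N * a.
  rewrite -(leq_exp2r #|S| _ (isT : 0 < 2)).
  rewrite -(leq_pmul2r (m := #|E| ^ 2)) ?expn_gt0 ?E_gt0 //; apply: leq_trans dense _.
  apply: (@leq_trans (2 * (N * #|E|) ^ 2 * a ^ 2)).
    by rewrite leq_mul2r leq_mul2l leq_exp2r // FN !orbT.
  have -> : 2 * (N * #|E|) ^ 2 * a ^ 2 = 2 * (N ^ 2 * a ^ 2 * #|E| ^ 2) by ring.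
  have -> : (2 * N * a) ^ 2 * #|E| ^ 2 = 4 * (N ^ 2 * a ^ 2 * #|E| ^ 2) by ring.
  by rewrite leq_mul2r orbT.
have a_gt0 : 0 < a.
  by rewrite lt0n; apply: contraTneq S_gt0 => a0; rewrite -leqNgt; move: Sa; rewrite a0 muln0.
pose nb s := #|[set s' in A | bad s s']|.
pose B := [set s in A | 4 * nb s <= a].
have BA : B \subset A by apply/subsetP => s /setIdP[].
have sum_nb : \sum_(s in A) nb s = #|bad_pairs x|.
  rewrite /nb -sum1_card (eq_bigl (fun t => (t.1 \in A) && ((t.2 \in A) && bad t.1 t.2))).
    rewrite -(pair_big_dep (mem A) (fun s s' => (s' \in A) && bad s s') (fun _ _ => 1)) /=.
    by apply: eq_bigr => s _; rewrite sum1dep_card.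
  by case=> s s'; rewrite inE in_setX /= andbA.
have Ba : 3 * a <= 4 * #|B|.
  (* Markov: each element of [A] outside [B] starts more than [a / 4] bad pairs, out of at most
     [a^2 / 16], so at most a quarter of [A] is lost. *)
  have aux (d m c n : nat) : d * n <= 4 * m -> 16 * m <= n ^ 2 -> n = c + d -> 0 < n -> 3 * n <= 4 * c.
    clear => H1 H2 E n0; have : d * 4 <= n by rewrite -(leq_pmul2r n0); nia.
    by lia.
  apply: (aux #|A :\: B| #|bad_pairs x|) => //; last first.
    by rewrite /a -(cardsID B A) (setIidPr BA).
  rewrite -sum_nb big_distrr /= [leqRHS](bigID (mem B)) /=.
  apply: leq_trans (leq_addl _ _); rewrite -sum_nat_const.
  rewrite [leqLHS](eq_bigl (fun s => (s \in A) && (s \notin B))); last first.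
    by move=> s; rewrite in_setD andbC.
  apply: leq_sum => s /andP[sA sB]; apply: ltnW; rewrite ltnNge.
  by apply: contra sB => H; apply/setIdP.
have B_gt0 : 0 < #|B| by move: Ba a_gt0; clear; lia.
have good_reps g : g \in ((B^-1)%g * B)%g ->
    a <= 2 * #|[set q in Q | (q^-1 * g)%g \in Q]|.
  move=> /mulsgP[u s']; rewrite inE => uB s'B ->; set s := u^-1%g in uB.
  have uE : u = s^-1%g by rewrite invgK.
  have inj : injective (fun c => s^-1 * c)%g by exact: mulgI.
  pose W := A :\: ([set c in A | bad s c] :|: [set c in A | bad s' c]).
  have Wa : a <= 2 * #|W|.
    have [/setIdP[_ n1] /setIdP[_ n2]] := (uB, s'B); rewrite -/(nb s) -/(nb s') in n1 n2.
    have := leq_card_setU [set c in A | bad s c] [set c in A | bad s' c] => -[HU _].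
    have := cardsID ([set c in A | bad s c] :|: [set c in A | bad s' c]) A.
    have := subset_leq_card (subsetIr A ([set c in A | bad s c] :|: [set c in A | bad s' c])).
    rewrite -/W -/a; move: n1 n2 HU; rewrite /nb.
    move: #|W| #|_ :&: _| #|_ :|: _| #|[set c in A | bad s c]| #|[set c in A | bad s' c]|.
    by clear; lia.
  apply: leq_trans Wa _; rewrite leq_mul2l /= -(card_imset _ inj).
  apply/subset_leq_card/subsetP => _ /imsetP[c /setDP[cA ncb] ->].
  have [b1 b2] : ~~ bad s c /\ ~~ bad s' c.
    by split; apply: contra ncb => H; apply/setUP; [left|right]; apply/setIdP.
  apply/setIdP; split; first by rewrite negbK in b1.
  rewrite uE invMg invgK -mulgA mulKVg; rewrite bad_sym negbK in b2; exact: b2.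
exists B; first by apply/subsetP => s /(subsetP BA)/setIdP[].
set C := ((B^-1)%g * B)%g in good_reps *.
have CQ : #|C| * a <= 2 * #|Q| ^ 2.
  rewrite -sum_nat_const; apply: (@leq_trans (\sum_(g in C) 2 * #|[set q in Q | (q^-1 * g)%g \in Q]|)).
    by apply: leq_sum => g; exact: good_reps.
  rewrite -big_distrr leq_mul2l /=.
  apply: (@leq_trans (\sum_(g : G) #|[set q in Q | (q^-1 * g)%g \in Q]|)).
    by rewrite [leqRHS](bigID (mem C)) leq_addr.
  under eq_bigr do rewrite -sum_nat_bool.
  rewrite exchange_big -mulnn -sum_nat_const; apply: leq_sum => q _.
  rewrite (reindex_inj (mulgI q)) /=; under eq_bigr do rewrite mulKg.
  by rewrite -sum1_card [leqRHS]big_mkcond; apply: leq_sum => g _; case: (g \in Q).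
have aB : a <= 2 * #|B| by move: Ba; clear; lia.
split=> //.
  apply: leq_trans Sa _; apply: (@leq_trans (2 * N * (2 * #|B|))); first by rewrite leq_mul2l aB orbT.
  rewrite (_ : 2 * N * (2 * #|B|) = 4 * (N * #|B|)); last by ring.
  rewrite (_ : N ^ 3 * #|B| = N ^ 2 * (N * #|B|)); last by ring.
  by rewrite leq_mul2r; apply/orP; right; apply: (@leq_trans (32 ^ 2)); rewrite ?leq_exp2r.
rewrite -(leq_pmul2r a_gt0); apply: leq_trans CQ _.
apply: (@leq_trans (2 * (N ^ 6 * #|S|) ^ 2)); first by rewrite leq_mul2l leq_exp2r ?Q_small ?orbT.
apply: (@leq_trans (2 * (N ^ 6 * (2 * N * a)) ^ 2)).
  by rewrite leq_mul2l leq_exp2r // leq_mul2l Sa !orbT.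
apply: (@leq_trans (2 * (N ^ 6 * (2 * N)) ^ 2 * a * (2 * #|B|))).
  rewrite (_ : 2 * (N ^ 6 * (2 * N * a)) ^ 2 = 2 * (N ^ 6 * (2 * N)) ^ 2 * a * a); last by ring.
  by rewrite leq_mul2l aB orbT.
rewrite (_ : 2 * (N ^ 6 * (2 * N)) ^ 2 * a * (2 * #|B|) = 16 * (N ^ 14 * #|B| * a)); last by ring.
rewrite (_ : N ^ 16 * #|B| * a = N ^ 2 * (N ^ 14 * #|B| * a)); last by ring.
by rewrite leq_mul2r; apply/orP; right; apply: (@leq_trans (32 ^ 2)); rewrite ?leq_exp2r.
Qed.
End Critical.

Lemma critical_bound : exists kappa : nat,
  forall (p : nat) (G : sl2_model p) (E : {set 'cV['F_p]_2}) (S : {set G}) (k N : nat),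
  prime p -> (2 < p)%N -> 0 \notin E -> E != set0 -> lines_meet_at_most E k ->
  (32 <= N)%N -> (#|image_of S E| <= N * #|E|)%N -> (p * k <= N * #|S|)%N ->
  (64 * #|image_of S E| <= p ^ 2)%N -> (N ^ kappa < #|S|)%N ->
  (forall (H : {group G}) g, H \proper [set: G] ->
     (N ^ kappa * #|S :&: (g *: H)%g| < #|S|)%N) ->
  (p ^ 6 <= N ^ kappa * #|S| ^ 2)%N.
Proof.
(* Here [|S| <= N^20 |D|] and [M <= N^(17 * 34)]. The three bounds serve, in order,
   nonconcentration, [M^9 < |D|], and replacing [M^10 |D|^2] by a multiple of [|S|^2] through
   [|D| <= N^17 |S|]. *)
have [kappa [k20 k9 k10]] : exists kappa, [/\ 20 <= kappa, 20 + 17 * 34 * 9 <= kappa &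
    17 * 34 * 10 + 17 * 2 <= kappa]%N.
  exists (20 + 17 * 34 * 9 + (17 * 34 * 10 + 17 * 2))%N; split.
  - by rewrite -addnA leq_addr.
  - exact: leq_addr.
  - exact: leq_addl.
exists kappa => p G E S k N p_pr p2 E0 En0 Ek N32 FN kN Fp Sbig nonconc.
have N_gt0 : (0 < N)%N by exact: leq_trans N32.
have powN i : (i <= kappa)%N -> (N ^ i <= N ^ kappa)%N by move=> ?; rewrite leq_pexp2l.
have S_gt0 : (0 < #|S|)%N by exact: leq_ltn_trans Sbig.
have Sn0 : S != set0 by rewrite -card_gt0.
have [B BS [B_gt0 SB CB]] := dense_small_quotient p_pr E0 En0 Sn0 Ek N32 FN kN Fp.
pose L := (N ^ 16)%N; have L_gt0 : (0 < L)%N by rewrite expn_gt0 N_gt0.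
have L2 : (2 * L <= N ^ 17)%N by rewrite expnS leq_mul2r (leq_trans _ N32) ?orbT.
have L64 : (64 <= 2 * L)%N.
  apply: (@leq_trans (2 * N)); first by rewrite -[64%N]/(2 * 32)%N leq_mul2l.
  by rewrite leq_mul2l -{1}(expn1 N) leq_pexp2l.
pose D := popular_quotients B L; pose M := ((2 * L) ^ 34)%N.
have [b bB Db] := popular_quotients_translate B_gt0 CB; rewrite -/D in Db.
have BD : (#|B| <= 2 * L * #|D|)%N.
  apply: leq_trans Db _; rewrite leq_mul2l; apply/orP; right.
  rewrite -(card_imset _ (mulIg b^-1%g)); apply/subset_leq_card/subsetP.
  by move=> _ /imsetP[a /setIdP[_ aD] ->].
have SD : (#|S| <= N ^ 20 * #|D|)%N.
  apply: leq_trans SB _; rewrite -[20%N]/(3 + 17)%N expnD.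
  by rewrite -mulnA leq_mul2l (leq_trans BD) ?orbT // leq_mul2r L2 orbT.
have DB : (#|D| <= 2 * L * #|B|)%N.
  by have := card_popular_pow B_gt0 CB 0; rewrite expg1 expn1 muln1.
have D17 : (#|(D ^+ 17)%g| <= M * #|D|)%N.
  apply: leq_trans (card_popular_pow B_gt0 CB 16) _.
  (* This is the origin of 34: [17 + 16] from the power of [D], and one more to replace [|B|] by
     [2 L |D|]. *)
  apply: (@leq_trans ((2 * L) ^ 17 * (2 * L) ^ 16 * (2 * L * #|D|))).
    by rewrite leq_mul // leq_mul2l leq_exp2r // leq_pmull // orbT.
  by rewrite mulnA -expnD -expnSr.
have M64 : (64 <= M)%N.
  by apply: leq_trans L64 _; rewrite -{1}(expn1 (2 * L)) leq_pexp2l // muln_gt0.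
have MN : (M <= N ^ (17 * 34))%N by rewrite /M expnM leq_exp2r.
have Dbig : (M ^ 9 < #|D|)%N.
  rewrite -(ltn_pmul2l (m := N ^ 20)) ?expn_gt0 ?N_gt0 //; apply: leq_trans SD.
  apply: leq_ltn_trans Sbig; apply: leq_trans (powN _ k9); rewrite expnD leq_mul2l.
  by rewrite (expnM N (17 * 34) 9) leq_exp2r // MN orbT.
have Dgen (H : {group G}) : H \proper [set: G] -> ~ D \subset H.
  (* If [D] lies in [H], a large part of [B] lies in the right coset [H b], which is the left coset
     of [b] for the conjugate subgroup [H :^ b]. *)
  move=> Hp DH; have Hbp : (H :^ b)%G \proper [set: G].
    have <- : ([set: G] :^ b)%g = [set: G] by apply/setP => x; rewrite mem_conjg !inE.
    by rewrite /= properJ.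
  have := nonconc (H :^ b)%G b Hbp; rewrite ltnNge => /negP[].
  apply: leq_trans (leq_mul (powN _ k20) (leqnn _)).
  apply: leq_trans SB _; rewrite -[20%N]/(3 + 17)%N expnD.
  rewrite -mulnA leq_mul2l; apply/orP; right; apply: leq_trans Db _.
  rewrite leq_mul //; apply/subset_leq_card/subsetP => a /setIdP[aB abD].
  apply/setIP; split; first exact: (subsetP BS).
  rewrite mem_lcoset mem_conjg conjgE invgK mulgA mulKVg.
  exact: (subsetP DH).
have := product_theorem p_pr p2 (popular_quotients1 B L_gt0)
  (popular_quotientsV B L) Dgen M64 D17 Dbig.
move=> /leq_trans -> //; apply: leq_trans (leq_mul (powN _ k10) (leqnn _)).
have BS' : (#|B| <= #|S|)%N by exact: subset_leq_card.
rewrite expnD -mulnA leq_mul //; first by rewrite (expnM N (17 * 34) 10) leq_exp2r.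
rewrite expnM -expnMn leq_exp2r //; apply: leq_trans DB _; exact: leq_mul.
Qed.

(** * Transfer to the general linear group *)

Section Model.
Variable p : nat.
Local Notation SG := (SL2_group p).
Local Notation T := (subg_of SG).

Definition sl2_mx (x : T) : 'M['F_p]_2 := GLval (sgval x).

Lemma sl2_mxM (x y : T) : sl2_mx (x * y)%g = sl2_mx x *m sl2_mx y.
Proof. by []. Qed.

Lemma sl2_mx_inj : injective sl2_mx.
Proof. by move=> x y E; apply/val_inj/val_inj. Qed.

Lemma sl2_mx_det x : \det (sl2_mx x) = 1.
Proof. by have := subgP x; rewrite inE => /eqP. Qed.

Lemma sl2_mx_lift (B : 'M['F_p]_2) : \det B = 1 -> exists x, sl2_mx x = B.
Proof.
move=> dB; have uB : (B : 'M_(2.-1.+1)) \is a GRing.unit by rewrite unitmxE dB unitr1.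
have gS : (FinRing.unit _ uB : {'GL_2['F_p]}) \in SG by rewrite inE dB.
by exists (Subg gS).
Qed.

Definition SL2_model : sl2_model p := Sl2Model sl2_mxM sl2_mx_inj sl2_mx_det sl2_mx_lift.
End Model.

Section Transfer.
Variable p : nat.
Local Notation SG := (SL2_group p).
Local Notation T := (SL2_model p).
Variable S : {set {'GL_2['F_p]}}.
Hypothesis SS : S \subset SL2 p.

Definition pullback : {set T} := [set x : T | sgval x \in S].

Lemma pullback_im : sgval @: pullback = S.
Proof.
apply/setP => g; apply/imsetP/idP => [[x]|gS]; first by rewrite inE => xS ->.
by have gG := subsetP SS _ gS; exists (Subg gG : T); rewrite ?inE.
Qed.

Lemma card_pullback : #|pullback| = #|S|.
Proof. by rewrite -[in RHS]pullback_im card_imset //; exact: val_inj. Qed.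

Lemma image_pullback (E E' : {set 'cV['F_p]_2}) : E' \subset E ->
  image_of pullback E' \subset image_set S E.
Proof.
move=> EE; apply/subsetP => _ /imset2P[x e xP eE ->]; rewrite inE in xP.
by apply/imset2P; exists (sgval x) e => //; exact: (subsetP EE).
Qed.

Lemma pullback_coset (H : {group T}) (g : T) : H \proper [set: T] ->
  exists (K : {group {'GL_2['F_p]}}) (h : {'GL_2['F_p]}),
  [/\ K \proper SL2 p, h \in SL2 p & (#|pullback :&: (g *: H)%g| <= #|S :&: (h *: K)%g|)%N].
Proof.
move=> Hp; pose K := (sgval @* H)%G.
have KE : K = sgval @: H :> {set _} by rewrite /= morphimE setTI.
have inK (x : T) : (sgval x \in K) = (x \in H).
  rewrite -[sgval x \in K]/(sgval x \in (K : {set _})) KE.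
  by rewrite mem_imset //; exact: val_inj.
exists K, (sgval g); split; last first.
- have inj : injective (sgval : T -> _) by exact: val_inj.
  rewrite -(card_imset _ inj); apply/subset_leq_card/subsetP.
  move=> _ /imsetP[x /setIP[xS /lcosetP[y yH xE]] ->]; apply/setIP; split.
    by rewrite inE in xS.
  by apply/lcosetP; exists (sgval y); rewrite ?inK // xE.
- exact: subgP.
have [_ [x _ xH]] := properP Hp; apply/properP; split.
  by apply/subsetP => h; rewrite KE => /imsetP[y _ ->]; exact: subgP.
by exists (sgval x); rewrite ?inK //; exact: subgP.
Qed.
End Transfer.

(** * Conclusion *)

(** Inserting [f >= e' >= e / 2] into the failed second bound gives [q k <= x s]; dividing that
    failure by the first bound gives [f <= x e']. *)
Lemma critical_range (R : realFieldType) (q k s e e' f x : R) :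
  0 < q -> 0 < k -> 0 < s -> 0 < e' -> 0 < x -> e <= 2 * e' -> e' <= e -> e' <= f ->
  s * e <= 24 * (q * k * f) -> f ^+ 2 * (q * k) < 64^-1 ^+ 2 * (s * e ^+ 2 * x) ->
  q * k <= x * s /\ f <= x * e'.
Proof.
move=> q0 k0 s0 e'0 x0 ee' e'e e'f H1 H2.
have e0 : 0 < e by exact: lt_le_trans e'e.
have f0 : 0 < f by exact: lt_le_trans e'f.
have qk0 : 0 < q * k by rewrite mulr_gt0.
have sx0 : 0 < s * x by rewrite mulr_gt0.
move: (q * k) qk0 H1 H2 => w w0 H1 H2; split.
  have e2 : 0 < e ^+ 2 by rewrite exprn_gt0.
  have ef : e ^+ 2 <= 4 * f ^+ 2.
    rewrite (_ : 4 * f ^+ 2 = (2 * f) ^+ 2); last by ring.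
    by rewrite ler_sqr ?nnegrE; lra.
  rewrite -(ler_pM2l e2).
  have : e ^+ 2 * w <= 4 * (f ^+ 2 * w) by rewrite mulrA ler_wpM2r // ltW.
  have sxe : 0 <= s * e ^+ 2 * x by rewrite !mulr_ge0 // ltW.
  move: (f ^+ 2 * w) H2 => y H2 H3; rewrite (_ : e ^+ 2 * (x * s) = s * e ^+ 2 * x); last by ring.
  by move: sxe H2 H3; move: (s * e ^+ 2 * x) => z; lra.
have ex0 : 0 < e * x by rewrite mulr_gt0.
have wf0 : 0 < w * f by rewrite mulr_gt0.
have H3 : f * (w * f) < (24 * 64^-1 ^+ 2 * (e * x)) * (w * f).
  have -> : f * (w * f) = f ^+ 2 * w by ring.
  apply: lt_le_trans H2 _.
  have -> : 64^-1 ^+ 2 * (s * e ^+ 2 * x) = (64^-1 ^+ 2 * (e * x)) * (s * e) by ring.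
  have -> : 24 * 64^-1 ^+ 2 * (e * x) * (w * f) = (64^-1 ^+ 2 * (e * x)) * (24 * (w * f)) by ring.
  by rewrite ler_wpM2l // mulr_ge0 ?sqr_ge0 // ltW.
rewrite ltr_pM2r // in H3.
have H4 : e * x <= 2 * (x * e').
  by rewrite mulrCA [e * x]mulrC ler_wpM2l // ltW.
have xe0 : 0 < x * e' by rewrite mulr_gt0.
move: H3 H4 xe0; move: (e * x) (x * e') => u v; lra.
Qed.

(* The hypothesis E != [set 0] excludes a degenerate case in which the bound
   fails: for E = {0} one has |S(E)| = 1 and k = 1 is allowed, while
   |S| |E| / (p k) = |S| / p can be a positive power of p.  For k = 0 the set E
   is empty and, as x / 0 = 0, the right-hand side is 0. *)
Theorem theorem1p2 (R : realType) (gamma : R) (hgamma : 0 < gamma < 1) :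
  exists eps : R, 0 < eps /\
  exists c : R, 0 < c /\
  exists p0 : nat,
  forall p : nat, prime p -> (p0 <= p)%N ->
  forall (E : {set 'cV['F_p]_2}) (S : {set {'GL_2['F_p]}}) (k : nat),
    E != [set 0] ->
    S \subset SL2 p ->
    S = (S^-1)%g ->
    p%:R `^ gamma < (#|S|%:R : R) < p%:R `^ (3 - 2 * gamma) ->
    (forall (H : {group {'GL_2['F_p]}}) (g : {'GL_2['F_p]}),
       H \proper SL2 p -> g \in SL2 p ->
       (#|S :&: (g *: H)%g|%:R : R) < p%:R `^ (- (gamma / 2)) * #|S|%:R) ->
    lines_meet_at_most E k ->
    c * Num.min (p%:R ^+ 2)
          (Num.max (#|S|%:R * #|E|%:R / (p%:R * k%:R))
                   (#|S|%:R `^ (1 / 2) * #|E|%:R /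
                      (p%:R `^ ((1 - eps) / 2) * k%:R `^ (1 / 2))))
    <= (#|image_set S E|%:R : R).
Proof.
have [kappa crit] := critical_bound; have /andP[g0 g1] := hgamma.
(* As [N <= x^2 = p^(2 eps)] below, [N^kappa] is at most [p^(gamma kappa / (2 (kappa + 1)))], within
   the saving [p^(gamma / 2)] allowed by nonconcentration. *)
pose eps : R := gamma / (4 * kappa.+1%:R).
have eps0 : 0 < eps by rewrite divr_gt0 ?mulr_gt0.
exists eps; split=> //; exists 64^-1; split; first by rewrite invr_gt0.
(* This size of [p] makes [p^eps >= 32]; the extra 3 ensures [2 < p]. *)
exists (Num.bound ((32 : R) `^ eps^-1)).+3 => p p_pr pp0 E S k En0 SS _ /andP[Slo Shi] nonconc Ek.
set s : R := #|S|%:R; set q : R := p%:R; set f0 : R := #|image_set S E|%:R.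
have p2 : (2 < p)%N by exact: leq_trans pp0.
have q1 : 1 <= q by rewrite ler1n prime_gt0.
have q0 : 0 < q by exact: lt_le_trans q1.
pose x := q `^ eps; have x32 : 32 <= x.
  have -> : (32 : R) = (32 `^ eps^-1) `^ eps by rewrite -powRrM mulVf ?lt0r_neq0 // powRr1.
  apply: ge0_ler_powR; rewrite ?nnegrE ?powR_ge0 // ?ltW //.
  apply: lt_le_trans (archi_boundP (powR_ge0 _ _)) _.
  by rewrite ler_nat; exact: (ltnW (ltnW (ltnW pp0))).
have x0 : 0 < x by lra.
pose N := (Num.truncn x).+1.
have [xN Nx] : x <= N%:R /\ N%:R <= x ^+ 2.
  have /andP[t1 t2] := truncn_itv (ltW x0); split; first exact: ltW.
  by rewrite /N -natr1 expr2; nra.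
have N32 : (32 <= N)%N by rewrite -(ler_nat R) (le_trans x32).
have Nk : N%:R ^+ kappa <= q `^ (gamma / 2).
  apply: (@le_trans _ _ ((x ^+ 2) ^+ kappa)); first by rewrite lerXn2r ?nnegrE ?ler0n ?exprn_ge0 // ltW.
  rewrite -exprM -powR_mulrn ?powR_ge0 // -powRrM ler_powR //.
  rewrite natrM /eps; have k0 : (0 : R) < kappa.+1%:R by rewrite ltr0n.
  rewrite mulrAC ler_pdivrMr ?mulr_gt0 //.
  have -> : gamma / 2 * (4 * kappa.+1%:R) = gamma * (2 * kappa.+1%:R) by field.
  by rewrite ler_wpM2l ?ler_wpM2l ?ler_nat // ltW.
have [->|En] := eqVneq E set0.
  apply: (@le_trans _ _ 0); last exact: ler0n.
  by rewrite cards0 !mulr0 !mul0r maxxx mulr_ge0_le0 ?invr_ge0 // ge_min lexx orbT.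
(* The counting excludes the origin; as [E] is neither empty nor the origin alone, removing it at
   most halves [E]. *)
pose E' := E :\ 0; have E'E : E' \subset E by exact: subsetDl.
have E'0 : 0 \notin E' by rewrite !inE eqxx.
have E'n : E' != set0.
  apply: contraNneq En0 => E'e; rewrite eqEsubset sub1set; apply/andP; split.
    by apply/subsetP => e eE; apply: contraT => e0; have := in_set0 e; rewrite -E'e !inE eE andbT -in_set1 e0.
  have /set0Pn[e eE] := En; have [<- //|e0] := eqVneq e 0.
  by have := in_set0 e; rewrite -E'e !inE eE e0.
have E'k : lines_meet_at_most E' k.
  move=> L /Ek; apply: leq_trans; apply/subset_leq_card/subsetP => e.
  by rewrite !inE => /andP[/andP[_ ->] ->].
have cE : (#|E| <= 2 * #|E'|)%N.
  rewrite (cardsD1 0 E) mul2n -addnn leq_add2r.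
  by apply: leq_trans (leq_b1 _) _; rewrite card_gt0.
have k_gt0 : (0 < k)%N.
  have /set0Pn[e eE'] := E'n.
  have e0 : e != 0 by apply: contraTneq eE' => ->.
  have /Ek : \dim <[e]>%VS = 1%N by rewrite dim_vline e0.
  apply: leq_trans; apply/card_gt0P; exists e.
  by rewrite inE (subsetP E'E) //= memv_line.
pose S' : {set SL2_model p} := pullback S.
have cS : #|S'| = #|S| by exact: card_pullback.
set F := image_of S' E'.
have Ff : (#|F| <= #|image_set S E|)%N by apply/subset_leq_card/image_pullback.
have s0 : 0 < s by apply: lt_trans Slo; exact: powR_gt0.
have S_gt0 : (0 < #|S|)%N by rewrite -(ltr0n R).
have S'n : S' != set0 by rewrite -card_gt0 cS.
have FE' : (#|E'| <= #|F|)%N.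
  have /set0Pn[g gS] := S'n; rewrite -(card_imset _ (@act_inj p _ g)).
  by apply/subset_leq_card/subsetP => _ /imsetP[e eE ->]; apply/imset2P; exists g e.
rewrite leNgt; apply/negP => small.
have {}small : #|F|%:R < 64^-1 * Num.min (q ^+ 2) (Num.max (s * #|E|%:R / (q * k%:R))
    (s `^ (1 / 2) * #|E|%:R / (q `^ ((1 - eps) / 2) * k%:R `^ (1 / 2)))).
  by apply: le_lt_trans small; rewrite ler_nat.
rewrite mulrC -ltr_pdivrMr ?invr_gt0 // invrK lt_min lt_max in small.
case/andP: small => Fq Fmax.
have Fp : (64 * #|F| <= p ^ 2)%N.
  by apply: ltnW; rewrite -(ltr_nat R) natrM natrX mulrC.
have IB := image_bound p_pr E'0 E'n E'k (_ : 2 * #|F| <= p ^ 2)%N.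
have {}IB : (#|S| * #|E'| <= 12 * (p * k * #|F|))%N.
  by rewrite -cS; apply: IB; apply: leq_trans Fp; rewrite leq_mul2r orbT.
have kR : 0 < k%:R :> R by rewrite ltr0n.
have E'R : 0 < #|E'|%:R :> R by rewrite ltr0n card_gt0.
have X1 : s * #|E|%:R <= 24 * (q * k%:R * #|F|%:R).
  rewrite -!natrM ler_nat; apply: leq_trans (leq_mul (leqnn _) cE) _.
  by rewrite mulnCA (_ : 24 = 2 * 12)%N // -mulnA leq_mul2l IB.
have qk0 : 0 < q * k%:R by rewrite mulr_gt0.
have F0 : 0 < #|F|%:R :> R by rewrite ltr0n (leq_trans _ FE') // card_gt0.
(* Since [64 > 24], failure against the first entry of the maximum contradicts [X1], so the second
   entry is the one that fails. *)
have {Fmax}F2 : #|F|%:R * 64 < s `^ (1 / 2) * #|E|%:R / (q `^ ((1 - eps) / 2) * k%:R `^ (1 / 2)).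
  case/orP: Fmax => //; rewrite ltr_pdivlMr // => H; exfalso.
  have := lt_le_trans H X1; rewrite ltNge => /negP; apply.
  rewrite (_ : #|F|%:R * 64 * (q * k%:R) = 64 * (q * k%:R * #|F|%:R)); last by ring.
  by rewrite ler_wpM2r ?mulr_ge0 ?ler_nat // ltW.
have {F2}F2 : #|F|%:R ^+ 2 * (q * k%:R) < 64^-1 ^+ 2 * (s * #|E|%:R ^+ 2 * x).
  have sq (y : R) : 0 <= y -> (y `^ (1 / 2)) ^+ 2 = y.
    by move=> y0; rewrite -powR_mulrn ?powR_ge0 // -powRrM divfK ?pnatr_eq0 // powRr1.
  have den : (q `^ ((1 - eps) / 2) * k%:R `^ (1 / 2)) ^+ 2 = q * k%:R / x.
    rewrite exprMn sq ?ler0n // -powR_mulrn ?powR_ge0 // -powRrM divfK ?pnatr_eq0 //.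
    by rewrite powRB ?lt0r_neq0 ?implybT // powRr1 ?ltW // mulrAC.
  have : (#|F|%:R * 64) ^+ 2 < (s `^ (1 / 2) * #|E|%:R / (q `^ ((1 - eps) / 2) * k%:R `^ (1 / 2))) ^+ 2.
    by rewrite ltr_sqr ?nnegrE // !mulr_ge0 ?invr_ge0 ?mulr_ge0 ?powR_ge0 ?ler0n.
  rewrite expr_div_n den [in ltRHS]exprMn sq ?ltW // ltr_pdivlMr ?divr_gt0 // => H.
  rewrite -(ltr_pM2l (x := 64 ^+ 2 / x)) ?divr_gt0 ?exprn_gt0 //.
  have -> : 64 ^+ 2 / x * (64^-1 ^+ 2 * (s * #|E|%:R ^+ 2 * x)) = s * #|E|%:R ^+ 2.
    by field; rewrite lt0r_neq0.
  by apply: le_lt_trans H; rewrite le_eqVlt; apply/orP; left; apply/eqP; ring.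
have [kN FN] : q * k%:R <= x * s /\ #|F|%:R <= x * #|E'|%:R.
  apply: critical_range X1 F2; rewrite // -?natrM ?ler_nat //.
  exact: subset_leq_card.
have {}kN : (p * k <= N * #|S'|)%N.
  by rewrite cS -(ler_nat R) !natrM (le_trans kN) // ler_wpM2r // ltW.
have {}FN : (#|F| <= N * #|E'|)%N.
  by rewrite -(ler_nat R) natrM (le_trans FN) // ler_wpM2r // ltW.
have Sbig : (N ^ kappa < #|S'|)%N.
  rewrite cS -(ltr_nat R) natrX; apply: le_lt_trans Nk (le_lt_trans _ Slo).
  by apply: ler_powR => //; clear -g0; lra.
have nonconc' (H : {group SL2_model p}) g : H \proper [set: SL2_model p] ->
    (N ^ kappa * #|S' :&: (g *: H)%g| < #|S'|)%N.
  move=> Hp; have [K [h [Kp hS le]]] := pullback_coset S g Hp.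
  rewrite cS; apply: leq_ltn_trans (leq_mul (leqnn _) le) _.
  rewrite -(ltr_nat R) natrM natrX.
  have qg0 : 0 < q `^ (gamma / 2) by exact: powR_gt0.
  apply: (@le_lt_trans _ _ (q `^ (gamma / 2) * #|S :&: (h *: K)%g|%:R)).
    by rewrite ler_wpM2r.
  apply: (lt_le_trans (y := q `^ (gamma / 2) * (q `^ (- (gamma / 2)) * s))).
    by rewrite ltr_pM2l // nonconc.
  by rewrite powRN mulVKf // lt0r_neq0.
have := crit p (SL2_model p) E' S' k N p_pr p2 E'0 E'n E'k N32 FN kN Fp Sbig nonconc'.
(* Contradiction of exponents: [N^kappa |S|^2 < p^(gamma / 2 + 2 (3 - 2 gamma)) <= p^6]. *)
rewrite cS leqNgt => /negP; apply.
rewrite -(ltr_nat R) natrM !natrX -/q -/s.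
apply: (@le_lt_trans _ _ (q `^ (gamma / 2) * s ^+ 2)).
  by rewrite ler_wpM2r // exprn_ge0 // ltW.
apply: (@lt_le_trans _ _ (q `^ (gamma / 2) * (q `^ (3 - 2 * gamma)) ^+ 2)).
  by rewrite ltr_pM2l ?powR_gt0 // ltr_sqr ?nnegrE ?powR_ge0 // ltW.
rewrite -powR_mulrn ?powR_ge0 // -powRrM -powRD ?lt0r_neq0 ?implybT //.
rewrite -[leRHS](powR_mulrn 6 (ltW q0)); apply: ler_powR => //.
by clear -g0; lra.
Qed.
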